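(* There exists a constant $C>1$, depending only on $n$ and $s$, such that the following holds. Let $\mu>0$ and let $F_*=\{(x_1,x')\in S: |x'|\le f(x_1)\}\in\mathcal K$ (with $f$ even and non-increasing on $[0,1/2]$) be a minimizer of $P_S$ in $\mathcal K$ under the volume constraint $|F_*|=\mu$, i.e. $P_S(F_* )\le P_S(F)$ for all $F\in\mathcal K$ with $|F|=\mu$. Then $$\frac{f(1/4)}{\mu^{\frac{1}{n-1}}}\le C\,\mu^{\frac{s}{n^2(n-1)}}.$$ Moreover, for every $\delta\in(0,1)$, if $\mu\in(0,C^{-1}\delta^{n^2/s})$ then $$\frac{|F_*\cap\{|x_1|\ge 1/4\}|}{|F_*|}\le\delta.$$
   Context: Fix $n\ge 2$ and $s\in(0,1)$. Write $x=(x_1,x')\in\mathbb R\times\mathbb R^{n-1}$, $e_1=(1,0,\dots,0)$, and let $S:=[-1/2,1/2]\times\mathbb R^{n-1}$. Define the kernel $K(x):=\sum_{k\in\mathbb Z}|x+ke_1|^{-n-s}$ (with values in $(0,+\infty]$), and for a measurable $E\subseteq\mathbb R^n$ set $P_S(E):=\int_{E\cap S}\int_{S\setminus E}K(x-y)\,dx\,dy$. The class $\mathcal K$ consists of all sets $F=\{(x_1,x')\in S: |x'|\le f(x_1)\}$ where $f:[-1/2,1/2]\to[0,+\infty]$ is even and non-increasing on $[0,1/2]$. $|\cdot|$ denotes Lebesgue measure. *)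

(* Defs.v *)
From HB Require Import structures.
From mathcomp Require Import all_boot all_order all_algebra.
From mathcomp Require Import all_classical all_reals all_analysis.
Unset Printing Implicit Defensive.
Import Order.TTheory GRing.Theory Num.Theory.
Local Open Scope classical_set_scope.
Local Open Scope ring_scope.

Fixpoint Rn (R : Type) (m : nat) : Type :=
  match m with 0 => unit | m'.+1 => (R * Rn R m')%type end.

Section Rn_defs.
Variable R : realType.

Fixpoint sqn (m : nat) : Rn R m -> R :=
  match m return Rn R m -> R with
  | 0 => fun _ => 0
  | m'.+1 => fun x => x.1 ^+ 2 + sqn m' x.2
  end.

Definition normn (m : nat) (x : Rn R m) : R := Num.sqrt (sqn m x).

Fixpoint subn_Rn (m : nat) : Rn R m -> Rn R m -> Rn R m :=
  match m return Rn R m -> Rn R m -> Rn R m with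
  | 0 => fun _ _ => tt
  | m'.+1 => fun x y => (x.1 - y.1, subn_Rn m' x.2 y.2)
  end.

(* Lebesgue integral of a nonnegative extended function on R^m, as the
   iterated one-dimensional Lebesgue integral (Tonelli). *)
Fixpoint intn (m : nat) : (Rn R m -> \bar R) -> \bar R :=
  match m return (Rn R m -> \bar R) -> \bar R with
  | 0 => fun f => f tt
  | m'.+1 => fun f =>
      (\int[@lebesgue_measure R]_t intn m' (fun y => f (t, y)))%E
  end.

(* Points of R^n (n >= 2) are written x = (x_1, x') in R * R^(n-1). *)
Definition pt (n : nat) := (R * Rn R n.-1)%type.

Definition intN (n : nat) (f : pt n -> \bar R) : \bar R :=
  (\int[@lebesgue_measure R]_t intn n.-1 (fun y => f (t, y)))%E.

Definition lebN (n : nat) (E : set (pt n)) : \bar R :=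
  intN n (fun x => (\1_E x)%:E).

Definition subpt (n : nat) (x y : pt n) : pt n := (x.1 - y.1, subn_Rn n.-1 x.2 y.2).

Definition rterm (n : nat) (s : R) (a : R) (y : Rn R n.-1) : \bar R :=
  let d := Num.sqrt (a ^+ 2 + sqn n.-1 y) in
  if d == 0 then +oo%E else (d `^ (- (n%:R + s)))%:E.

(* K(x) = sum_{k in Z} |x + k e_1|^{-n-s}, in (0, +oo] *)
Definition Kker (n : nat) (s : R) (x : pt n) : \bar R :=
  (\sum_(0 <= k <oo)
     (rterm n s (x.1 + k%:R) x.2 + rterm n s (x.1 - k.+1%:R) x.2))%E.

Definition strip (n : nat) : set (pt n) := [set x | `|x.1| <= 2^-1].

Definition PS (n : nat) (s : R) (E : set (pt n)) : \bar R :=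
  intN n (fun y => ((\1_(E `&` strip n) y)%:E *
    intN n (fun x => (\1_(strip n `\` E) x)%:E * Kker n s (subpt n x y)))%E).

(* admissible profiles f : [-1/2,1/2] -> [0,+oo], even, non-increasing
   on [0,1/2] (values outside [-1/2,1/2] are irrelevant) *)
Definition profile (f : R -> \bar R) : Prop :=
  (forall t, `|t| <= 2^-1 -> (0 <= f t)%E) /\
  (forall t, `|t| <= 2^-1 -> f (- t) = f t) /\
  (forall t u, 0 <= t -> t <= u -> u <= 2^-1 -> (f u <= f t)%E).

Definition Kset (n : nat) (f : R -> \bar R) : set (pt n) :=
  [set x | x \in strip n /\ ((normn n.-1 x.2)%:E <= f x.1)%E].

Definition inK (n : nat) (E : set (pt n)) : Prop :=
  exists f, profile f /\ E = Kset n f.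

End Rn_defs.

Arguments sqn {R}. Arguments normn {R}. Arguments subn_Rn {R}. Arguments intn {R}.
Arguments pt {R}. Arguments intN {R}. Arguments lebN {R}. Arguments subpt {R}.
Arguments rterm {R}. Arguments Kker {R}. Arguments strip {R}. Arguments PS {R}.
Arguments profile {R}. Arguments Kset {R}. Arguments inK {R}.

(* Main.v *)
Require Import Defs.
From HB Require Import structures.
From mathcomp Require Import all_boot all_order all_algebra.
From mathcomp Require Import all_classical all_reals all_analysis.
From mathcomp Require Import measurable_realfun ring lra.
Import Order.TTheory GRing.Theory Num.Theory.
Local Open Scope classical_set_scope.
Local Open Scope ring_scope.

(** Let [F] be the minimizer, [m = n - 1], [r = f(1/4)].  Since [f >= f(1/8)] on [|x_1| <= 1/8], the
    volume constraint forces [f <= rho := C mu^(1/m)] on [1/8 <= |x_1| <= 1/2].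
    A point of [F] with [1/8 <= x_1 <= 1/4] then sees a cube of side comparable to
    [rho] in [S \ F] at distance comparable to [rho], whence
    [P_S(F) >= c r^m mu^(-s/m)] for small [mu].  A cylinder of volume [mu] whose
    radius and height are comparable to [mu^(1/n)] lies in the class and has
    [P_S <= C mu^(1-s/n)].  Minimality gives [r^m <= C mu^(1 + s/(nm))], which is
    stronger than the claim when [mu] is small; for [mu] bounded below the claim is
    the trivial bound [r <= C mu^(1/m)].  The second assertion follows since
    [F] restricted to [|x_1| >= 1/4] lies in a box of volume [(2r)^m].

    The integral of a nonnegative function is a supremum over simple functions
    below it, so it is monotone without measurability; all estimates only compare
    with explicit step functions, and no measurability of slices is ever needed.

    For the cylinder, the distance of an inner point [y] to the complement is at
    least a multiple of [d = rho u v], [u = 1 - y_1^2/a^2], [v = 1 - |y'|^2/rho^2];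
    outside the ball of radius [d] the kernel is dominated by the product over the
    coordinates of [(d + |x_i - y_i|)^(-1-s/n)], with integral [C d^(-s)], and
    [d^(-s)] is again a product of functions integrable because [s < 1]. *)

(** * Integrals of nonnegative functions on the line *)

Section OneDimensional.
Variable R : realType.
Local Notation mu := (@lebesgue_measure R).
Implicit Types (f g : R -> \bar R) (t k : R).

Lemma le_ge0_integral f g :
  (forall t, 0 <= f t)%E -> (forall t, f t <= g t)%E ->
  (\int[mu]_t f t <= \int[mu]_t g t)%E.
Proof.
move=> f0 fg.
have g0 t : (0 <= g t)%E by exact: le_trans (fg t).
rewrite !ge0_integralTE//; apply: ereal_sup_le => _ [h /= hf <-].
by exists h => //= t; exact: le_trans (fg t).
Qed.

(** The series of step functions dominates [f] pointwise: one term already does, and the others are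
    nonnegative. The sets [S j] may overlap, and only the step functions have to be measurable. *)
Lemma integral_cover_le f (S : nat -> set R) (c : nat -> \bar R) :
  (forall t, 0 <= f t)%E -> (forall j, measurable (S j)) ->
  (forall j, 0 <= c j)%E ->
  (forall t, f t = 0%E \/ exists2 j, S j t & (f t <= c j)%E) ->
  (\int[mu]_t f t <= \sum_(0 <= j <oo) (c j * mu (S j)))%E.
Proof.
move=> f0 mS c0 cover.
pose g (j : nat) t := (c j * (\1_(S j) t)%:E)%E.
have mi j : measurable_fun setT (fun t : R => (\1_(S j) t : R)%:E).
  by apply/measurable_EFinP; exact: measurable_indic.
have g0 j t : setT t -> (0 <= g j t)%E by move=> _; apply: mule_ge0.
have mg j : measurable_fun setT (g j) by exact: measurable_funeM.
have -> : (\sum_(0 <= j <oo) c j * mu (S j) =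
           \int[mu]_t (\sum_(0 <= j <oo) g j t))%E.
  rewrite integral_nneseries//; apply: eq_eseriesr => j _.
  rewrite ge0_integralZl; [|exact: measurableT|exact: mi|by []|by []].
  rewrite integral_indic; [|exact: measurableT|exact: mS].
  by congr (_ * mu _)%E; apply/esym/setIT.
apply: le_ge0_integral => // t.
have [->|[j Sj fj]] := cover t; first by apply: nneseries_ge0 => j _ _; exact: g0.
rewrite (@nneseriesD1 _ _ j)//; last by move=> i _; exact: g0.
apply: (le_trans fj); rewrite -[leLHS]adde0; apply: leeD.
  by rewrite /g indicE mem_set// mule1.
by apply: nneseries_ge0 => i _ _; exact: g0.
Qed.

(* The exceptional points [p], [q] carry the boundary values, where the functions to
   be estimated may be infinite. *)
Lemma integral_cover_off_le (p q : R) f (S : nat -> set R) (c : nat -> R) :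
  (forall t, 0 <= f t)%E -> (forall j, measurable (S j)) ->
  (forall j, 0 <= c j) ->
  (forall t, t != p -> t != q ->
     f t = 0%E \/ exists2 j, S j t & (f t <= (c j)%:E)%E) ->
  (\int[mu]_t f t <= \sum_(0 <= j <oo) ((c j)%:E * mu (S j)))%E.
Proof.
move=> f0 mS c0 cover.
(* The two exceptional points become a set of index 0 with value [+oo]; it is null, and
   [+oo * 0 = 0]. *)
pose S' j := if j is i.+1 then S i else ([set p] `|` [set q]).
pose c' j := (if j is i.+1 then (c i)%:E else +oo)%E.
have mN : measurable ([set p] `|` [set q] : set R).
  by apply: measurableU; exact: measurable_set1.
have mu0 : mu ([set p] `|` [set q]) = 0%E.
  apply/eqP; rewrite -measure_le0; apply: le_trans (measureU2 _ _ _) _;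
    [exact: measurable_set1|exact: measurable_set1|].
  by have := lebesgue_measure_set1 p; have := lebesgue_measure_set1 q;
     move=> /= -> ->; rewrite adde0.
have := @integral_cover_le f S' c' f0.
have c'0 j : (0 <= c' j)%E by case: j => [|j] /=; rewrite ?leey ?lee_fin.
rewrite (@nneseries_recl _ _ (fun j => c' j * mu (S' j))%E) //; last first.
  by move=> j _; exact: mule_ge0.
rewrite /= mu0 mule0 add0e => H.
have -> : (\sum_(0 <= j <oo) ((c j)%:E * mu (S j)) =
   \sum_(1 <= j <oo) (c' j * mu (S' j)))%E.
  rewrite -(@nneseries_addn _ _ 1)//=; first by apply: eq_eseriesr => j _; rewrite addn1.
  by move=> j; apply: mule_ge0.
apply: H; [by case=> [|j] /=; [exact: mN|exact: mS]|exact: c'0|move=> t].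
have [->|tp] := eqVneq t p; first by right; exists 0%N; [left|rewrite leey].
have [->|tq] := eqVneq t q; first by right; exists 0%N; [right|rewrite leey].
by have [->|[j ? ?]] := cover t tp tq; [left|right; exists j.+1].
Qed.

Lemma lebesgue_measure_cc (a b : R) : a <= b -> mu `[a, b] = (b - a)%:E.
Proof.
move=> ab; rewrite lebesgue_measure_itv/= lte_fin.
move: ab; rewrite le_eqVlt => /predU1P[->|->]; last by rewrite EFinB.
by rewrite ltxx subrr.
Qed.

Lemma integral_cc_cst (a b k : R) : a <= b ->
  (\int[mu]_t (if (a <= (t : R) <= b)%R then k%:E else 0) = (k * (b - a))%:E)%E.
Proof.
move=> ab; rewrite EFinM -lebesgue_measure_cc// -[RHS]integral_cst//.
rewrite [RHS]integral_mkcond; apply: eq_integral => t _.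
rewrite /patch; have -> : (t \in `[a, b]%classic) = (a <= t <= b).
  by rewrite mem_setE in_itv.
by case: ifP.
Qed.

Lemma integral_ge_cc f (a b k : R) : a <= b -> 0 <= k ->
  (forall t, 0 <= f t)%E -> (forall t, (a <= (t : R) <= b)%R -> k%:E <= f t)%E ->
  ((k * (b - a))%:E <= \int[mu]_t f t)%E.
Proof.
move=> ab k0 f0 fk; rewrite -integral_cc_cst//; apply: le_ge0_integral => t.
  by case: ifP.
by case: ifPn => // /fk.
Qed.

Lemma integral_le_cc f (a b k : R) : a <= b -> 0 <= k ->
  (forall t, 0 <= f t)%E -> (forall t, (a <= (t : R) <= b)%R -> f t <= k%:E)%E ->
  (forall t, ~~ ((a <= (t : R) <= b)%R) -> f t = 0)%E ->
  (\int[mu]_t f t <= (k * (b - a))%:E)%E.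
Proof.
move=> ab k0 f0 fk fz; rewrite -integral_cc_cst//; apply: le_ge0_integral => // t.
by case: ifPn => [/fk|/fz ->].
Qed.

Lemma nneseries_le (u : nat -> R) (B : R) : (forall j, 0 <= u j) ->
  (forall N, \sum_(0 <= j < N) u j <= B) ->
  (\sum_(0 <= j <oo) (u j)%:E <= B%:E)%E.
Proof.
move=> u0 uB; apply: lime_le.
  by apply: is_cvg_nneseries => j _ _; rewrite lee_fin.
by apply: nearW => N; rewrite sumEFin lee_fin.
Qed.

End OneDimensional.

(** * One-dimensional power integrals *)

Section PowerIntegrals.
Variable R : realType.
Local Notation mu := (@lebesgue_measure R).
Implicit Types (f : R -> \bar R) (t k : R).

Lemma powRN_le (x y e : R) : 0 < x -> x <= y -> 0 <= e ->
  y `^ (- e) <= x `^ (- e).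
Proof.
move=> x0 xy e0; have y0 : 0 < y by exact: lt_le_trans xy.
rewrite !powRN lef_pV2 ?posrE ?powR_gt0//.
by apply: ge0_ler_powR => //; rewrite nnegrE ltW.
Qed.

Lemma gt0_powRD (x r e : R) : 0 < x -> x `^ (r + e) = x `^ r * x `^ e.
Proof. by move=> x0; rewrite powRD// (gt_eqF x0) implybT. Qed.

(** A discrete integral comparison. Divided by [(x + 1) ^ (- e)], it reads
    [1 + e / (x + 1) <= (x / (x + 1)) ^ (- e)], which follows from [1 + z <= expR z] and
    [ln (1 + z) <= z]. *)
Lemma powR_telescope (x e : R) : 0 < x -> 0 < e ->
  (x + 1) `^ (- (1 + e)) <= e^-1 * (x `^ (- e) - (x + 1) `^ (- e)).
Proof.
move=> x0 e0; have y0 : 0 < x + 1 by rewrite addr_gt0.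
have -> : (x + 1) `^ (- (1 + e)) = (x + 1)^-1 * (x + 1) `^ (- e).
  rewrite opprD gt0_powRD//.
  by rewrite powR_inv1// ltW.
have -> : x `^ (- e) = (x / (x + 1)) `^ (- e) * (x + 1) `^ (- e).
  by rewrite -powRM ?divr_ge0 ?ltW// divfK// gt_eqF.
rewrite -[X in _ - X]mul1r -mulrBl mulrA ler_wpM2r ?powR_ge0//.
rewrite mulrC ler_pdivlMr// lerBrDl.
have xy0 : 0 < x / (x + 1) by rewrite divr_gt0.
rewrite /powR gt_eqF//; apply: le_trans (expR_ge1Dx _).
rewrite lerD2l mulNr.
have : ln (x / (x + 1)) <= x / (x + 1) - 1.
  have e1 : 1 + (x / (x + 1) - 1) = x / (x + 1) by ring.
  by rewrite -[X in ln X]e1; apply: le_ln1Dx; lra.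
have -> : x / (x + 1) - 1 = - (x + 1)^-1 by field; rewrite gt_eqF.
by nra.
Qed.

Lemma sum_powRN_le (e : R) (N : nat) : 0 < e ->
  \sum_(0 <= j < N) (j.+1%:R : R) `^ (- (1 + e)) <= 1 + e^-1.
Proof.
move=> e0; case: N => [|N].
  by rewrite big_geq// addr_ge0// invr_ge0 ltW.
(* The induction needs the sharper bound that keeps the telescoping remainder. *)
suff : \sum_(0 <= j < N.+1) (j.+1%:R : R) `^ (- (1 + e)) <=
    1 + e^-1 * (1 - N.+1%:R `^ (- e)).
  move=> /le_trans; apply; rewrite lerD2l.
  have : 0 < e^-1 by rewrite invr_gt0.
  by have := powR_ge0 (N.+1%:R : R) (- e); nra.
elim: N => [|N IH]; first by rewrite big_nat1 !powR1 subrr mulr0 addr0.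
rewrite big_nat_recr//=; apply: (le_trans (lerD IH _)).
  by rewrite -[N.+2]addn1 natrD; apply: powR_telescope.
rewrite -[N.+2]addn1 natrD -addrA -mulrDr.
by rewrite (_ : _ + (_ - _) = 1 - (N.+1%:R + 1) `^ (- e))//; ring.
Qed.

Lemma lebesgue_measure_cc2_le (a b a' b' w : R) : a <= b -> a' <= b' ->
  b - a <= w -> b' - a' <= w ->
  (mu (`[a, b] `|` `[a', b']) <= (2 * w)%:E)%E.
Proof.
move=> ab ab' w1 w2.
apply: le_trans (measureU2 _ _ _) _; [exact: measurable_itv|exact: measurable_itv|].
have := lebesgue_measure_cc R _ _ ab; have := lebesgue_measure_cc R _ _ ab'.
by move=> /= -> ->; rewrite -EFinD lee_fin; lra.
Qed.

(** The line is covered by pairs of intervals of length [d], the [j]-th pair at distance between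
    [d * j] and [d * (j + 1)] from [c]. There the integrand is at most
    [k * (d * (j + 1)) ^ (- (1 + e))], and the sum over [j] converges. *)
Lemma integral_tail_le (e d c k : R) f : 0 < e -> 0 < d -> 0 <= k ->
  (forall t, 0 <= f t)%E ->
  (forall t, f t <= (k * (d + `|t - c|) `^ (- (1 + e)))%:E)%E ->
  (\int[mu]_t f t <= (k * (2 * (1 + e^-1)) * d `^ (- e))%:E)%E.
Proof.
move=> e0 d0 k0 f0 fk.
pose S (j : nat) : set R := `[c - d * j.+1%:R, c - d * j%:R] `|`
  `[c + d * j%:R, c + d * j.+1%:R].
pose w (j : nat) := k * (d * j.+1%:R) `^ (- (1 + e)).
have w0 j : 0 <= w j by rewrite mulr_ge0// powR_ge0.
have mS j : measurable (S j) by apply: measurableU; exact: measurable_itv.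
have dj (j : nat) : d * j%:R <= d * j.+1%:R by rewrite ler_pM2l// ler_nat.
apply: le_trans (@integral_cover_le R f S (EFin \o w) f0 mS _ _) _.
- by move=> j; rewrite lee_fin.
- move=> t; right; exists (Num.truncn (`|t - c| / d)).
    have /andP[] : (Num.truncn (`|t - c| / d))%:R <= `|t - c| / d <
        (Num.truncn (`|t - c| / d)).+1%:R.
      by apply: truncn_itv; rewrite divr_ge0// ltW.
    rewrite ler_pdivlMr// ltr_pdivrMr// mulrC [X in _ < X]mulrC.
    set j := Num.truncn _ => h1 /ltW h2.
    have [tc|tc] := leP 0 (t - c).
      rewrite ger0_norm// in h1 h2.
      by right; rewrite /= in_itv/=; apply/andP; split; lra.
    rewrite ltr0_norm// in h1 h2.
    by left; rewrite /= in_itv/=; apply/andP; split; lra.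
  apply: (le_trans (fk t)); rewrite lee_fin /w ler_wpM2l//.
  apply: powRN_le; first by rewrite mulr_gt0.
    have : (Num.truncn (`|t - c| / d))%:R <= `|t - c| / d.
      by rewrite truncn_le divr_ge0// ltW.
    by rewrite ler_pdivlMr// -natr1; lra.
  by rewrite addr_ge0// ltW.
have h j : ((EFin \o w) j * mu (S j) <=
    (k * d `^ (- e) * 2 * (j.+1%:R `^ (- (1 + e))))%:E)%E.
  have -> : k * d `^ (- e) * 2 * (j.+1%:R `^ (- (1 + e))) = w j * (2 * d).
    rewrite /w powRM ?(ltW d0)// opprD (gt0_powRD d)//.
    rewrite powR_inv1 ?(ltW d0)//; field; by rewrite gt_eqF.
  rewrite EFinM; apply: lee_wpmul2l; first by rewrite lee_fin.
  by apply: lebesgue_measure_cc2_le; rewrite -?natr1; have := dj j; rewrite -?natr1; lra.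
have v0 j : 0 <= k * d `^ (- e) * 2 * (j.+1%:R `^ (- (1 + e))).
  by rewrite !mulr_ge0// powR_ge0.
apply: (@le_trans _ _ (\sum_(0 <= j <oo)
   (k * d `^ (- e) * 2 * (j.+1%:R `^ (- (1 + e))))%:E)%E).
  by apply: lee_nneseries => [j _ _|j _]; [apply: mule_ge0; rewrite ?lee_fin|exact: h].
apply: nneseries_le => // N; rewrite -mulr_sumr.
rewrite [leRHS](_ : _ = k * d `^ (- e) * 2 * (1 + e^-1)); last by ring.
by apply: ler_wpM2l (sum_powRN_le _ _ e0); rewrite !mulr_ge0// powR_ge0.
Qed.

Lemma dyadic_scale (x : R) : 0 < x -> x <= 1 ->
  exists j : nat, 2^-1 ^+ j.+1 < x <= 2^-1 ^+ j.
Proof.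
move=> x0 x1.
have ex : exists j : nat, 2^-1 ^+ j.+1 < x.
  exists (Num.truncn x^-1); rewrite exprVn invf_plt ?posrE ?exprn_gt0//.
  apply: (lt_le_trans (truncnS_gt _)).
  by rewrite -natrX ler_nat ltnW// ltn_expl.
exists (ex_minn ex); case: ex_minnP => j -> jmin /=.
case: j jmin => [|j] jmin; first by rewrite expr0.
by rewrite leNgt; apply/negP => /jmin; rewrite ltnn.
Qed.

Lemma geometric_sum_le (z : R) N : 0 <= z -> z < 1 ->
  \sum_(0 <= j < N) z ^+ j <= (1 - z)^-1.
Proof.
move=> z0 z1; rewrite big_mkord -[leRHS]mul1r ler_pdivlMr ?subr_gt0// mulrC.
have := subrX1 z N; have : 0 <= z ^+ N by exact: exprn_ge0.
by set S := \sum_(_ < _) _; lra.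
Qed.

(* Dyadic decomposition according to the distance of [t] to the end points. *)
Lemma integral_dome_le_neg (be : R) : -1 < be -> be <= 0 ->
  exists2 C : R, 0 < C & forall (A k : R) f, 0 < A -> 0 <= k ->
  (forall t, 0 <= f t)%E ->
  (forall t, (t ^+ 2 < A)%R -> f t <= (k * (A - t ^+ 2) `^ be)%:E)%E ->
  (forall t, (A < t ^+ 2)%R -> f t = 0)%E ->
  (\int[mu]_t f t <= (k * C * A `^ (be + 2^-1))%:E)%E.
Proof.
(* [z] is the ratio of a geometric series: from one covering set to the next the length halves and
   the bound on [f] gains the factor [2^-1 ^ be]. It is below 1 because [be > -1]. *)
move=> b1 b0; pose z : R := 2^-1 `^ (1 + be).
have h0 : 0 < (2^-1 : R) by rewrite invr_gt0.
have z0 : 0 <= z by exact: powR_ge0.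
have z1 : z < 1.
  have : 2^-1 `^ (1 + be) < (1 : R) `^ (1 + be).
    by apply: gt0_ltr_powR; rewrite ?nnegrE; lra.
  by rewrite powR1.
pose hb : R := 2^-1 `^ be.
have hb0 : 0 < hb by exact: powR_gt0.
exists (2 * hb * (1 - z)^-1); first by rewrite !mulr_gt0// invr_gt0 subr_gt0.
move=> A k f A0 k0 f0 fk fz; pose b : R := Num.sqrt A.
have b_gt0 : 0 < b by rewrite sqrtr_gt0.
have bA : b ^+ 2 = A by rewrite sqr_sqrtr// ltW.
pose h j : R := 2^-1 ^+ j.
have hj0 j : 0 < h j by exact: exprn_gt0.
pose S (j : nat) : set R := `[- b, - b + b * h j] `|` `[b - b * h j, b].
pose w (j : nat) := k * (A * h j.+1) `^ be.
have w0 j : 0 <= w j by rewrite mulr_ge0// powR_ge0.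
have mS j : measurable (S j) by apply: measurableU; exact: measurable_itv.
apply: le_trans (@integral_cover_off_le R b (- b) f S w f0 mS w0 _) _.
  move=> t tb tNb.
  have [tA|tA|tA] := ltgtP (t ^+ 2) A; last first.
  - by exfalso; move/eqP: tA; rewrite -bA eqf_sqr (negbTE tb) (negbTE tNb).
  - by left; exact: fz.
  right; have nt : `|t| < b.
    by rewrite -(ltr_pXn2r (n := 2))// ?nnegrE ?ltW// bA real_normK ?num_real.
  have [||j /andP[j1 j2]] := @dyadic_scale (1 - `|t| / b).
  - by rewrite subr_gt0 ltr_pdivrMr// mul1r.
  - by rewrite lerBlDr lerDl divr_ge0// ltW.
  have e1 : b * (1 - `|t| / b) = b - `|t| by field; rewrite gt_eqF.
  exists j.
    have : b - `|t| <= b * h j by rewrite -e1 ler_pM2l.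
    have [t0|t0] := leP 0 t.
      rewrite ger0_norm// => h2; right; rewrite /= in_itv/=.
      by rewrite ger0_norm// in nt; apply/andP; split; lra.
    rewrite ltr0_norm// => h2; left; rewrite /= in_itv/=.
    by rewrite ltr0_norm// in nt; apply/andP; split; lra.
  apply: (le_trans (fk t tA)); rewrite lee_fin /w ler_wpM2l//.
  (* As [be <= 0] the power is non-increasing, and [A - t ^+ 2 = (b - |t|) * (b + |t|) >= b * (b -
     |t|) >= A * h j.+1]. *)
  rewrite -[be]opprK; apply: powRN_le; rewrite ?oppr_ge0// ?mulr_gt0//.
  have h3 : b * h j.+1 <= b - `|t| by rewrite -e1 ler_pM2l// ltW.
  have n0 : 0 <= `|t| by [].
  have -> : t ^+ 2 = `|t| ^+ 2 by rewrite real_normK ?num_real.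
  rewrite -bA [leLHS](_ : _ = b * (b * h j.+1)); last by ring.
  by nra.
have hE j : ((w j)%:E * (2 * (b * h j))%:E)%E =
    (k * (2 * hb) * A `^ (be + 2^-1) * z ^+ j)%:E.
  rewrite -EFinM; congr EFin.
  rewrite /w powRM ?(ltW A0) ?(ltW (hj0 _))// gt0_powRD//.
  rewrite powR12_sqrt ?(ltW A0)// -/b.
  have -> : h j.+1 `^ be = hb * hb ^+ j.
    rewrite -exprS /h -!powR_mulrn ?powR_ge0 ?(ltW h0)//.
    by rewrite /hb powRAC.
  have -> : z ^+ j = hb ^+ j * h j.
    by rewrite /z gt0_powRD// exprMn powRr1 ?(ltW h0)// mulrC.
  by ring.
have v0 j : 0 <= k * (2 * hb) * A `^ (be + 2^-1) * z ^+ j.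
  by rewrite !mulr_ge0 ?powR_ge0 ?exprn_ge0// ltW.
apply: (@le_trans _ _ (\sum_(0 <= j <oo)
   (k * (2 * hb) * A `^ (be + 2^-1) * z ^+ j)%:E)%E).
  apply: lee_nneseries => [j _ _|j _]; first by apply: mule_ge0; rewrite ?lee_fin.
  rewrite -hE; apply: lee_wpmul2l; first by rewrite lee_fin.
  have bh : 0 <= b * h j by rewrite mulr_ge0// ltW.
  by apply: lebesgue_measure_cc2_le; lra.
apply: nneseries_le => // N; rewrite -mulr_sumr.
rewrite [leRHS](_ : _ = k * (2 * hb) * A `^ (be + 2^-1) * (1 - z)^-1); last by ring.
by apply: ler_wpM2l (geometric_sum_le _ _ z0 z1); rewrite !mulr_ge0 ?powR_ge0// ltW.
Qed.

(** Positive exponents occur because each coordinate integrated in [intn_dome_le] raises the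
    exponent by one half. For these the integrand is at most [k * A ^ be], and the case of exponent
    0 applies. *)
Lemma integral_dome_le (be : R) : -1 < be ->
  exists2 C : R, 0 < C & forall (A k : R) f, 0 < A -> 0 <= k ->
  (forall t, 0 <= f t)%E ->
  (forall t, (t ^+ 2 < A)%R -> f t <= (k * (A - t ^+ 2) `^ be)%:E)%E ->
  (forall t, (A < t ^+ 2)%R -> f t = 0)%E ->
  (\int[mu]_t f t <= (k * C * A `^ (be + 2^-1))%:E)%E.
Proof.
move=> b1; have [b0|b0] := leP be 0; first exact: integral_dome_le_neg.
have [||C C0 HC] := @integral_dome_le_neg 0; [lra|lra|].
exists C => // A k f A0 k0 f0 fk fz.
apply: le_trans (HC A (k * A `^ be) f A0 _ f0 _ fz) _.
- by rewrite mulr_ge0// powR_ge0.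
- move=> t tA; apply: (le_trans (fk t tA)); rewrite lee_fin powRr0 mulr1.
  rewrite ler_wpM2l// ge0_ler_powR ?nnegrE ?(ltW b0) ?(ltW A0) ?subr_ge0 ?(ltW tA)//.
  by rewrite lerBlDr lerDl sqr_ge0.
rewrite lee_fin add0r gt0_powRD//.
by rewrite le_eqVlt; apply/orP; left; apply/eqP; ring.
Qed.

End PowerIntegrals.

(** * Iterated integrals *)

Section IteratedIntegral.
Variable R : realType.
Local Notation mu := (@lebesgue_measure R).
Implicit Types (m : nat) (k : R).

Lemma intn_ge0 m (f : Rn R m -> \bar R) :
  (forall y, 0 <= f y)%E -> (0 <= intn m f)%E.
Proof.
elim: m f => [|m IH] f f0 /=; first exact: f0.
by apply: integral_ge0 => t _; apply: IH => y; exact: f0.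
Qed.

Lemma le_intn m (f g : Rn R m -> \bar R) :
  (forall y, 0 <= f y)%E -> (forall y, f y <= g y)%E -> (intn m f <= intn m g)%E.
Proof.
elim: m f g => [|m IH] f g f0 fg /=; first exact: fg.
apply: le_ge0_integral => t; first by apply: intn_ge0 => y; exact: f0.
by apply: IH => y; [exact: f0|exact: fg].
Qed.

Lemma intn_cst0 m : intn m (fun=> 0%E : \bar R) = 0%E.
Proof. by elim: m => //= m ->; rewrite integral0_eq. Qed.

Lemma intn_eq0 m (f : Rn R m -> \bar R) : (forall y, f y = 0%E) -> intn m f = 0%E.
Proof. by move=> /funext ->; exact: intn_cst0. Qed.

Fixpoint inbox m (l h : R) : Rn R m -> bool :=
  match m with
  | 0 => fun _ => true
  | m'.+1 => fun x => (l <= x.1 <= h) && inbox m' l h x.2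
  end.

Lemma intn_box m (l h k : R) : l <= h ->
  intn m (fun y => if inbox m l h y then k%:E else 0%E) = (k * (h - l) ^+ m)%:E.
Proof.
move=> lh; elim: m => [|m IH] /=; first by rewrite expr0 mulr1.
rewrite exprSr mulrA -integral_cc_cst//; apply: eq_integral => t _.
by case: ifP => _ //=; rewrite intn_cst0.
Qed.

Lemma intn_ge_box m (f : Rn R m -> \bar R) (l h k : R) : l <= h -> 0 <= k ->
  (forall y, 0 <= f y)%E -> (forall y, inbox m l h y -> k%:E <= f y)%E ->
  ((k * (h - l) ^+ m)%:E <= intn m f)%E.
Proof.
move=> lh k0 f0 fk; rewrite -intn_box//; apply: le_intn => y.
  by case: ifP => _; rewrite ?lee_fin.
by case: ifP => [/fk|].
Qed.

Lemma intn_le_box m (f : Rn R m -> \bar R) (l h k : R) : l <= h -> 0 <= k ->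
  (forall y, 0 <= f y)%E -> (forall y, inbox m l h y -> f y <= k%:E)%E ->
  (forall y, ~~ inbox m l h y -> f y = 0%E) ->
  (intn m f <= (k * (h - l) ^+ m)%:E)%E.
Proof.
move=> lh k0 f0 fk fz; rewrite -intn_box//; apply: le_intn => // y.
by case: ifPn => [/fk|/fz ->].
Qed.

Lemma sqn_ge0 m (y : Rn R m) : 0 <= sqn m y.
Proof. by elim: m y => //= m IH y; rewrite addr_ge0// sqr_ge0. Qed.

Lemma sqn_le_inbox m (h : R) (y : Rn R m) : 0 <= h -> inbox m 0 h y ->
  sqn m y <= m%:R * h ^+ 2.
Proof.
move=> h0; elim: m y => [|m IH] /= y; first by rewrite mul0r.
move=> /andP[/andP[y0 yh] /IH {}IH]; rewrite -natr1 mulrDl mul1r addrC.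
by apply: lerD => //; rewrite ler_pXn2r ?nnegrE.
Qed.

Lemma sqn_le_sqr_inbox m (h : R) (y : Rn R m) : (0 < m)%N -> 0 <= h ->
  inbox m 0 (h / m%:R) y -> sqn m y <= h ^+ 2.
Proof.
move=> m0 h0 /sqn_le_inbox H.
have mR : 1 <= m%:R :> R by rewrite ler1n.
apply: (le_trans (H _)); first by rewrite divr_ge0.
rewrite expr_div_n mulrCA ler_piMr ?sqr_ge0// expr2 invfM mulrA divff ?gt_eqF ?ltr0n//.
by rewrite mul1r invf_le1// ltr0n.
Qed.

Lemma inbox_sqn_le m (h : R) (y : Rn R m) : 0 <= h -> sqn m y <= h ^+ 2 ->
  inbox m (- h) h y.
Proof.
move=> h0; elim: m y => //= m IH y yh.
have s0 := sqn_ge0 m y.2; have q0 := sqr_ge0 y.1.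
rewrite IH ?andbT; last by lra.
rewrite -ler_norml -(ler_pXn2r (n := 2))// ?nnegrE//.
by rewrite real_normK ?num_real//; lra.
Qed.

(** Induction on the dimension: once the tails satisfy [X <= Z + Y] as numbers, what remains is the
    triangle inequality in the plane, obtained from Cauchy-Schwarz ([cs]). *)
Lemma normn_triangle m (x y : Rn R m) :
  normn m x <= normn m (subn_Rn m x y) + normn m y.
Proof.
rewrite /normn; elim: m x y => [|m IH] /= x y; first by rewrite sqrtr0 addr0.
have := IH x.2 y.2.
set X := sqn m x.2; set Y := sqn m y.2; set Z := sqn m _.
have X0 : 0 <= X by exact: sqn_ge0. have Y0 : 0 <= Y by exact: sqn_ge0.
have Z0 : 0 <= Z by exact: sqn_ge0.
rewrite -{2}(sqr_sqrtr X0) -{2}(sqr_sqrtr Y0) -{2}(sqr_sqrtr Z0).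
have := sqrtr_ge0 X; have := sqrtr_ge0 Y; have := sqrtr_ge0 Z.
move: (Num.sqrt X) (Num.sqrt Y) (Num.sqrt Z) => {X0 Y0 Z0}{}X {}Y {}Z Z0 Y0 X0 XYZ.
move: x.1 y.1 => a b.
have P0 : 0 <= (a - b) ^+ 2 + Z ^+ 2 by rewrite addr_ge0 ?sqr_ge0.
have Q0 : 0 <= b ^+ 2 + Y ^+ 2 by rewrite addr_ge0 ?sqr_ge0.
rewrite -[leRHS]ger0_norm ?addr_ge0 ?sqrtr_ge0//.
rewrite -sqrtr_sqr ler_wsqrtr// sqrrD !sqr_sqrtr//.
have cs : (a - b) * b + Z * Y <=
    Num.sqrt ((a - b) ^+ 2 + Z ^+ 2) * Num.sqrt (b ^+ 2 + Y ^+ 2).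
  apply: (le_trans (ler_norm _)); rewrite -sqrtrM// -sqrtr_sqr ler_wsqrtr//.
  by have := sqr_ge0 ((a - b) * Y - Z * b); rewrite !expr2; lra.
have : X ^+ 2 <= (Z + Y) ^+ 2 by rewrite ler_pXn2r ?nnegrE// addr_ge0.
move: cs; set T := _ * Num.sqrt _; rewrite !expr2 mulr2n; lra.
Qed.

(** A separable substitute for the radial kernel away from the diagonal. With [e = s / n] the [n]
    exponents add up to [n + s], and the iterated integral factors. *)
Fixpoint tensor m (e d : R) : Rn R m -> Rn R m -> R :=
  match m with
  | 0 => fun _ _ => 1
  | m'.+1 => fun y x => (d + `|x.1 - y.1|) `^ (- (1 + e)) * tensor m' e d y.2 x.2
  end.

Lemma tensor_ge0 m (e d : R) y x : 0 <= tensor m e d y x.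
Proof. by elim: m y x => //= m IH y x; rewrite mulr_ge0// powR_ge0. Qed.

Lemma intn_tensor_le m (e d k : R) (f : Rn R m -> \bar R) (y : Rn R m) :
  0 < e -> 0 < d -> 0 <= k -> (forall x, 0 <= f x)%E ->
  (forall x, f x <= (k * tensor m e d y x)%:E)%E ->
  (intn m f <= (k * (2 * (1 + e^-1) * d `^ (- e)) ^+ m)%:E)%E.
Proof.
move=> e0 d0; elim: m k f y => [|m IH] k f y k0 f0 fk /=.
  by have := fk tt; rewrite expr0.
set B := 2 * (1 + e^-1) * d `^ (- e).
have B0 : 0 <= B by rewrite !mulr_ge0 ?powR_ge0// addr_ge0// invr_ge0 ltW.
rewrite [k * _](_ : _ = (k * B ^+ m) * (2 * (1 + e^-1)) * d `^ (- e)); last first.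
  by rewrite exprS /B; ring.
apply: (integral_tail_le _ _ _ y.1) => //.
- by rewrite mulr_ge0// exprn_ge0.
- by move=> t; apply: intn_ge0 => x; exact: f0.
move=> t; rewrite mulrAC; apply: (IH _ _ y.2) => [|x|x].
- by rewrite mulr_ge0// powR_ge0.
- exact: f0.
- by apply: (le_trans (fk (t, x))); rewrite /= mulrA.
Qed.

(** Each factor has base [d + |x_i - y_i| <= 2 * l], since both summands are at most [l]. *)
Lemma tensor_ge m (e d l : R) (y x : Rn R m) : 0 <= e -> 0 < d -> d <= l ->
  sqn m (subn_Rn m x y) <= l ^+ 2 ->
  ((2 * l) `^ (- (1 + e))) ^+ m <= tensor m e d y x.
Proof.
move=> e0 d0 dl; elim: m y x => //= m IH y x h.
have l0 : 0 <= l by exact: ltW (lt_le_trans d0 dl).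
have s0 := sqn_ge0 m (subn_Rn m x.2 y.2); have q0 := sqr_ge0 (x.1 - y.1).
rewrite exprS; apply: ler_pM; rewrite ?exprn_ge0 ?powR_ge0//; last by apply: IH; lra.
apply: powRN_le; [exact: ltr_pwDl| |exact: addr_ge0].
rewrite mulr2n mulrDl mul1r; apply: lerD => //.
rewrite -(ler_pXn2r (n := 2))// ?nnegrE//.
by rewrite real_normK ?num_real//; lra.
Qed.

(** Fixing the first coordinate [t] replaces [A] by [A - t ^+ 2], so the inner integral is again a
    dome in [t], now with exponent [be + m / 2]. *)
Lemma intn_dome_le m (be : R) : -1 < be ->
  exists2 C : R, 0 < C & forall (A k : R) (f : Rn R m -> \bar R), 0 < A -> 0 <= k ->
  (forall y, 0 <= f y)%E ->
  (forall y, (sqn m y < A)%R -> f y <= (k * (A - sqn m y) `^ be)%:E)%E ->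
  (forall y, A < sqn m y -> f y = 0%E) ->
  (intn m f <= (k * C * A `^ (be + m%:R / 2))%:E)%E.
Proof.
move=> b1; elim: m => [|m [C C0 IH]].
  exists 1 => // A k f A0 k0 f0 fk _ /=.
  by have := fk tt; rewrite /= subr0 mul0r addr0 mulr1; apply.
have [|D D0 HD] := integral_dome_le R (be + m%:R / 2).
  by rewrite ltr_wpDr// divr_ge0.
exists (C * D); first exact: mulr_gt0.
move=> A k f A0 k0 f0 fk fz /=.
rewrite -natr1 mulrDl mul1r (addrA be) mulrA; apply: HD => //.
- by rewrite mulr_ge0// ltW.
- by move=> t; apply: intn_ge0 => y; exact: f0.
- move=> t tA; apply: IH => // [|y h|y h].
  + by rewrite subr_gt0.
  + by apply: le_trans (fk (t, y) _) _ => /=; rewrite ?opprD ?addrA//; lra.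
  + by apply: fz => /=; lra.
- move=> t tA; apply: intn_eq0 => y; apply: fz => /=.
  by rewrite ltr_wpDr// sqn_ge0.
Qed.

(* The sets of the class always contain the segment [x' = 0], on which the inner
   integral of the perimeter of a cylinder may be infinite. *)
Lemma intn_axis m (f : Rn R m -> \bar R) : (0 < m)%N ->
  (forall y, 0 <= f y)%E -> (forall y, 0 < sqn m y -> f y = 0%E) ->
  intn m f = 0%E.
Proof.
case: m f => // m f _ f0 fz; apply/eqP; rewrite eq_le intn_ge0// andbT /=.
apply: le_trans (@integral_cover_off_le R 0 0 _ (fun=> set0) (fun=> 0) _ _ _ _) _ => //.
- by move=> t; apply: intn_ge0 => y; exact: f0.
- move=> t t0 _; left; apply: intn_eq0 => y; apply: fz => /=.
  by rewrite ltr_pwDl ?sqn_ge0// exprn_even_gt0.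
- by rewrite eseries0// => j _ _; rewrite mul0e.
Qed.

End IteratedIntegral.

(** * The periodic kernel *)

Section Kernel.
Variable R : realType.
Implicit Types (m : nat) (s : R).

Lemma rterm_ge0 (n : nat) s a (y : Rn R n.-1) : (0 <= rterm n s a y)%E.
Proof. by rewrite /rterm; case: ifP => // _; rewrite lee_fin powR_ge0. Qed.

Lemma rterm_pair_ge0 (n : nat) s (x : @pt R n) (k : nat) :
  (0 <= rterm n s (x.1 + k%:R) x.2 + rterm n s (x.1 - k.+1%:R) x.2)%E.
Proof. by apply: adde_ge0; exact: rterm_ge0. Qed.

Lemma Kker_ge0 (n : nat) s (x : @pt R n) : (0 <= Kker n s x)%E.
Proof. by apply: nneseries_ge0 => k _ _; exact: rterm_pair_ge0. Qed.

Lemma rterm_ge (n : nat) s a (y : Rn R n.-1) (D : R) : 0 <= s -> 0 < D ->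
  a ^+ 2 + sqn n.-1 y <= D ^+ 2 -> ((D `^ (- (n%:R + s)))%:E <= rterm n s a y)%E.
Proof.
move=> s0 D0 h; rewrite /rterm; case: eqP => [_|/eqP l0]; first exact: leey.
rewrite lee_fin; apply: powRN_le; last exact: addr_ge0.
  by rewrite lt0r l0 sqrtr_ge0.
by rewrite -[leRHS]gtr0_norm// -sqrtr_sqr ler_wsqrtr.
Qed.

Lemma Kker_ge (n : nat) s (x : @pt R n) (D : R) : 0 <= s -> 0 < D ->
  x.1 ^+ 2 + sqn n.-1 x.2 <= D ^+ 2 ->
  ((D `^ (- (n%:R + s)))%:E <= Kker n s x)%E.
Proof.
move=> s0 D0 h; rewrite /Kker (@nneseriesD1 _ _ 0%N)//; last first.
  by move=> k _; exact: rterm_pair_ge0.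
rewrite -[leLHS]adde0; apply: leeD; last first.
  by apply: nneseries_ge0 => k _ _; exact: rterm_pair_ge0.
rewrite -[leLHS]adde0; apply: leeD; last exact: rterm_ge0.
by apply: rterm_ge => //; rewrite addr0.
Qed.

Lemma rterm_le m s (a d : R) (y x : Rn R m) : 0 < s -> 0 < d ->
  d ^+ 2 <= a ^+ 2 + sqn m (subn_Rn m x y) ->
  (rterm m.+1 s a (subn_Rn m x y) <=
   (2 `^ (m.+1%:R + s) *
    ((d + `|a|) `^ (- (1 + s / m.+1%:R)) * tensor R m (s / m.+1%:R) d y x))%:E)%E.
Proof.
move=> s0 d0 h; rewrite /rterm /=; set l := Num.sqrt _.
have n0 : 0 < m.+1%:R :> R by rewrite ltr0n.
have e0 : 0 < s / m.+1%:R by rewrite divr_gt0.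
have dl : d <= l by rewrite -[leLHS]gtr0_norm// -sqrtr_sqr ler_wsqrtr.
have l0 : 0 < l by exact: lt_le_trans dl.
rewrite gt_eqF// lee_fin.
(* The number [a] becomes the first coordinate: the points [(a, x)] and [(0, y)] have distance [l]
   in dimension [m.+1]. *)
have := @tensor_ge R m.+1 (s / m.+1%:R) d l (0, y) (a, x) (ltW e0) d0 dl.
rewrite /= !subr0 sqr_sqrtr ?addr_ge0 ?sqr_ge0 ?sqn_ge0// lexx => /(_ isT).
have -> : ((2 * l) `^ (- (1 + s / m.+1%:R))) ^+ m.+1 =
    2 `^ (- (m.+1%:R + s)) * l `^ (- (m.+1%:R + s)).
  rewrite -powR_mulrn ?powR_ge0// -powRrM -powRM ?(ltW l0)//; congr (_ `^ _).
  by field; rewrite gt_eqF.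
rewrite [2 `^ (- _)]powRN ler_pdivrMl ?powR_gt0//.
Qed.

(* Every shifted term is at most a constant times [(k + 1)^(-1-s/n)] times the
   unshifted product bound, because [|x_1 - y_1| <= 3/4] and [d <= 1]. *)
Lemma Kker_le m s (d : R) (y x : @pt R m.+1) : 0 < s -> 0 < d -> d <= 1 ->
  `|x.1 - y.1| <= 3 / 4 ->
  (forall k : nat,
    d ^+ 2 <= (x.1 - y.1 + k%:R) ^+ 2 + sqn m (subn_Rn m x.2 y.2)) ->
  (forall k : nat,
    d ^+ 2 <= (x.1 - y.1 - k.+1%:R) ^+ 2 + sqn m (subn_Rn m x.2 y.2)) ->
  (Kker m.+1 s (subpt m.+1 x y) <=
   (2 `^ (m.+1%:R + s) * (2 * 16 `^ (1 + s / m.+1%:R) * (1 + (s / m.+1%:R)^-1)) *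
    tensor R m.+1 (s / m.+1%:R) d y x)%:E)%E.
Proof.
move=> s0 d0 d1 z34 h1 h2; rewrite /Kker /=.
have n0 : 0 < m.+1%:R :> R by rewrite ltr0n.
move eE : (s / m.+1%:R) => e.
have e0 : 0 < e by rewrite -eE divr_gt0.
set z := x.1 - y.1 in z34 h1 h2 *.
set T := tensor R m e d y.2 x.2; have T0 : 0 <= T by exact: tensor_ge0.
set w := d + `|z|.
have w0 : 0 < w by rewrite ltr_pwDl.
have w2 : w <= 2 by rewrite /w; lra.
have key (k : nat) (b : R) : k.+1%:R * w / 16 <= d + `|b| ->
   d ^+ 2 <= b ^+ 2 + sqn m (subn_Rn m x.2 y.2) ->
   (rterm m.+1 s b (subn_Rn m x.2 y.2) <= (2 `^ (m.+1%:R + s) *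
     (16 `^ (1 + e) * (w `^ (- (1 + e)) * T) * (k.+1%:R `^ (- (1 + e)))))%:E)%E.
  move=> hk hb; apply: (le_trans (rterm_le _ _ _ _ _ _ s0 d0 hb)).
  rewrite eE lee_fin ler_wpM2l ?powR_ge0//.
  have kw : 0 < k.+1%:R * w / 16 by rewrite !mulr_gt0// invr_gt0.
  have e10 : 0 <= 1 + e by rewrite addr_ge0// ltW.
  have := powRN_le R _ _ _ kw hk e10.
  rewrite (powRM _ (mulr_ge0 (ler0n _ _) (ltW w0))) ?invr_ge0//.
  rewrite (powRM _ (ler0n _ _) (ltW w0)).
  have -> : 16^-1 `^ (- (1 + e)) = 16 `^ (1 + e) :> R.
    by rewrite -[16^-1]powR_inv1// -powRrM mulN1r opprK.
  move=> /(ler_wpM2r T0) /le_trans; apply.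
  by rewrite le_eqVlt; apply/orP; left; apply/eqP; ring.
have zb := ler_norml z (3 / 4); rewrite z34 in zb; move/esym/andP: zb => [zl zr].
(* Origin of the constant 16: as [w <= 2], the left side is at most [(k + 1) / 8], while
   [|z| <= 3 / 4] gives [|z + k| >= k - 3 / 4] for [k >= 1] and [|z - (k + 1)| >= k + 1 / 4]. *)
have k1 (k : nat) : k.+1%:R * w / 16 <= d + `|z + k%:R|.
  case: k => [|k]; first by rewrite addr0 -/w; lra.
  have := ler_norm (z + k.+1%:R); have := ler0n R k.
  have : k.+2%:R * w <= k.+2%:R * 2 by rewrite ler_wpM2l.
  by rewrite -[k.+2%:R]natr1 -[k.+1%:R]natr1; lra.
have k2 (k : nat) : k.+1%:R * w / 16 <= d + `|z - k.+1%:R|.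
  have := ler_norm (- (z - k.+1%:R)); rewrite normrN.
  have := ler0n R k; have : k.+1%:R * w <= k.+1%:R * 2 by rewrite ler_wpM2l.
  by rewrite -[k.+1%:R]natr1; lra.
set M := 2 `^ (m.+1%:R + s) * (2 * 16 `^ (1 + e) * (1 + e^-1)) * _.
pose c := 2 `^ (m.+1%:R + s) * (16 `^ (1 + e) * (w `^ (- (1 + e)) * T)) * 2.
have c0 : 0 <= c by rewrite !mulr_ge0 ?powR_ge0.
apply: (@le_trans _ _ (\sum_(0 <= k <oo) (c * (k.+1%:R `^ (- (1 + e))))%:E)%E).
  apply: lee_nneseries => [k _ _|k _].
    by apply: adde_ge0; exact: rterm_ge0.
  rewrite [X in X%:E](_ : _ = (2 `^ (m.+1%:R + s) *
     (16 `^ (1 + e) * (w `^ (- (1 + e)) * T) * (k.+1%:R `^ (- (1 + e))))) +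
     (2 `^ (m.+1%:R + s) *
     (16 `^ (1 + e) * (w `^ (- (1 + e)) * T) * (k.+1%:R `^ (- (1 + e)))))); last first.
    by rewrite /c; ring.
  by rewrite EFinD; apply: leeD; apply: key.
apply: nneseries_le => [k|N]; first by rewrite mulr_ge0 ?powR_ge0.
rewrite -mulr_sumr [M](_ : _ = c * (1 + e^-1)); last by rewrite /M /c /=; ring.
exact: ler_wpM2l (sum_powRN_le _ _ _ e0).
Qed.

Lemma normn_le m (y : Rn R m) (h : R) : 0 <= h ->
  (normn m y <= h) = (sqn m y <= h ^+ 2).
Proof.
move=> h0; rewrite -(ler_sqrt (sqn m y)) ?exprn_ge0//.
by rewrite sqrtr_sqr ger0_norm.
Qed.

End Kernel.

(** * Lower bound for the minimizer *)

Section LowerBound.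
Variable R : realType.
Implicit Types (m : nat) (s : R).

Lemma KsetP (n : nat) (f : R -> \bar R) (x : @pt R n) :
  Kset n f x <-> `|x.1| <= 2^-1 /\ ((normn n.-1 x.2)%:E <= f x.1)%E.
Proof. by split=> -[h1 h2]; split=> //; [move: h1; rewrite inE|rewrite inE]. Qed.

Lemma indic_mule_in (T : Type) (A : set T) (x : T) (z : \bar R) : A x ->
  ((\1_A x)%:E * z = z)%E.
Proof. by move=> Ax; rewrite indicE mem_set// mul1e. Qed.

Lemma indic_mule_notin (T : Type) (A : set T) (x : T) (z : \bar R) : ~ A x ->
  ((\1_A x)%:E * z = 0)%E.
Proof. by move=> Ax; rewrite indicE memNset// mul0e. Qed.

Lemma indic_mule_ge0 (T : Type) (A : set T) (x : T) (z : \bar R) : (0 <= z)%E ->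
  (0 <= (\1_A x)%:E * z)%E.
Proof. by move=> z0; apply: mule_ge0 => //; rewrite lee_fin. Qed.

Lemma inner_ge0 (n : nat) s (A : set (@pt R n)) (y : pt n) :
  (0 <= intN n (fun x => (\1_A x)%:E * Kker n s (subpt n x y)))%E.
Proof.
apply: integral_ge0 => t _; apply: intn_ge0 => x.
by apply: indic_mule_ge0; exact: Kker_ge0.
Qed.

Lemma inbox_sub m (l h l' h' : R) (y : Rn R m) : l' <= l -> h <= h' ->
  inbox R m l h y -> inbox R m l' h' y.
Proof.
move=> ll hh; elim: m y => //= m IH y /andP[/andP[a b] /IH ->].
by rewrite (le_trans ll a) (le_trans b hh).
Qed.

Lemma sqn_ge_inbox m (l h : R) (x : Rn R m) : (0 < m)%N -> 0 <= l ->
  inbox R m l h x -> l ^+ 2 <= sqn m x.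
Proof.
case: m x => //= m x _ l0 /andP[/andP[x1 _] _].
by rewrite -[leLHS]addr0 lerD ?sqn_ge0// ler_pXn2r ?nnegrE// (le_trans l0).
Qed.

Lemma sqn_sub_le_inbox m (h : R) (x y : Rn R m) : 0 <= h ->
  inbox R m 0 h x -> inbox R m 0 h y -> sqn m (subn_Rn m x y) <= m%:R * h ^+ 2.
Proof.
move=> h0; elim: m x y => [|m IH] /= x y; first by rewrite mul0r.
move=> /andP[/andP[a b] xb] /andP[/andP[a' b'] yb].
have {}IH := IH _ _ xb yb; rewrite -natr1 mulrDl mul1r addrC lerD//.
rewrite -[leLHS]real_normK ?num_real// ler_pXn2r ?nnegrE//.
by rewrite ler_norml; apply/andP; split; lra.
Qed.

Lemma profile_le_norm (f : R -> \bar R) (t u : R) : profile f ->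
  `|t| <= u -> u <= 2^-1 -> (f u <= f t)%E.
Proof.
move=> [_ [fev fdec]] tu u2.
have t2 : `|t| <= 2^-1 by exact: le_trans u2.
have -> : f t = f `|t|.
  by have [?|?] := leP 0 t; [rewrite ger0_norm|rewrite ltr0_norm// fev].
exact: fdec.
Qed.

(** For [t] in [[1/8, 1/4]] and [y] in the cube [[0, r/m]^m], the point [(t, y)] is in the set. The
    box [[t, t + rho]] times [[2 rho, 4 rho]^m] lies in the complement, as [f <= rho] beyond [1/8],
    and in the strip, as [rho <= 1/4]. All distances between the two are at most [D = 4 n rho]. *)
Lemma PS_ge m s : (0 < m)%N -> 0 < s ->
  exists2 c : R, 0 < c & forall (f : R -> \bar R) (r rho : R),
  profile f -> 0 <= r -> 0 < rho -> rho <= 4^-1 ->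
  (r%:E <= f (4^-1)%R)%E -> (f (8^-1)%R <= rho%:E)%E ->
  ((c * r ^+ m * rho `^ (- s))%:E <= PS m.+1 s (Kset m.+1 f))%E.
Proof.
move=> m0 s0; set n := m.+1.
have mR : 0 < m%:R :> R by rewrite ltr0n.
have nR : 1 <= n%:R :> R by rewrite ler1n.
have n0 : 0 < n%:R :> R by rewrite ltr0n.
exists ((4 * n%:R) `^ (- (n%:R + s)) * 2 ^+ m * m%:R^-1 ^+ m * 8^-1).
  by rewrite !mulr_gt0 ?powR_gt0 ?exprn_gt0 ?invr_gt0 ?mulr_gt0.
move=> f r rho pf r0 rho0 rho4 rf frho.
have rrho : r <= rho.
  rewrite -lee_fin; apply: (le_trans rf); apply: le_trans frho.
  by apply: profile_le_norm => //; rewrite ?ger0_norm; lra.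
pose D := 4 * n%:R * rho; have D0 : 0 < D by rewrite !mulr_gt0.
pose I := D `^ (- (n%:R + s)) * (4 * rho - 2 * rho) ^+ m * rho.
have I0 : 0 <= I.
  by rewrite !mulr_ge0 ?powR_ge0 ?exprn_ge0//; lra.
have -> : (4 * n%:R) `^ (- (n%:R + s)) * 2 ^+ m * m%:R^-1 ^+ m * 8^-1
    * r ^+ m * rho `^ (- s) = I * (r / m%:R - 0) ^+ m * (4^-1 - 8^-1).
  have n4 : 0 <= 4 * n%:R :> R by rewrite mulr_ge0.
  rewrite /I /D (powRM _ n4 (ltW rho0)).
  have -> : 4 * rho - 2 * rho = 2 * rho by ring.
  have -> : rho `^ (- (n%:R + s)) = rho ^- n * rho `^ (- s).
    by rewrite opprD gt0_powRD// powR_invn// ltW.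
  have -> : 4^-1 - 8^-1 = 8^-1 :> R by lra.
  rewrite subr0 expr_div_n exprVn exprMn /n exprS.
  by field; rewrite !(gt_eqF, expf_neq0).
have fp t y : (0 <= (\1_(Kset n f `&` strip n) (t, y))%:E *
    intN n (fun x => (\1_(strip n `\` Kset n f) x)%:E *
      Kker n s (subpt n x (t, y))))%E.
  by apply: indic_mule_ge0; exact: inner_ge0.
rewrite /PS /intN; apply: integral_ge_cc => [||t|t /andP[t8 t4]].
- lra.
- by rewrite mulr_ge0// exprn_ge0// subr0 divr_ge0// ltW.
- by apply: intn_ge0 => y; exact: fp.
have tn : `|t| <= 4^-1 by rewrite ger0_norm; lra.
apply: intn_ge_box => [|||y yb] //.
- by rewrite divr_ge0// ltW.
rewrite indic_mule_in; last first.
  split; last by rewrite /strip /=; lra.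
  apply/KsetP; split=> /=; first by lra.
  apply: (@le_trans _ _ r%:E).
    by rewrite lee_fin normn_le//; apply: sqn_le_sqr_inbox yb.
  by apply: (le_trans rf); apply: profile_le_norm => //; lra.
have -> : I = D `^ (- (n%:R + s)) * (4 * rho - 2 * rho) ^+ m * (t + rho - t).
  by rewrite [t + rho]addrC addrK.
have xp u x : (0 <= (\1_(strip n `\` Kset n f) (u, x))%:E *
      Kker n s (subpt n (u, x) (t, y)))%E.
  by apply: indic_mule_ge0; exact: Kker_ge0.
apply: integral_ge_cc => [||u|u /andP[ut ut']].
- lra.
- by rewrite !mulr_ge0 ?powR_ge0 ?exprn_ge0//; lra.
- by apply: intn_ge0 => x; exact: xp.
apply: intn_ge_box => [|||x xb].
- lra.
- exact: powR_ge0.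
- by move=> x; exact: xp.
have un : `|u| <= 2^-1 by rewrite ger0_norm; lra.
rewrite indic_mule_in; last first.
  split=> //; move/KsetP => /= [_]; apply/negP; rewrite -ltNge.
  apply: (@le_lt_trans _ _ rho%:E).
    apply: le_trans frho; case: pf => _ [_]; apply; lra.
  rewrite lte_fin ltNge (normn_le _ _ _ _ (ltW rho0)) -ltNge.
  have r20 : 0 <= 2 * rho by lra.
  by have := sqn_ge_inbox m _ _ x m0 r20 xb; nra.
apply: Kker_ge => //=; first exact: ltW.
have : sqn m (subn_Rn m x y) <= m%:R * (4 * rho) ^+ 2.
  apply: sqn_sub_le_inbox; first by lra.
    by apply: inbox_sub xb; lra.
  apply: inbox_sub yb; first by [].
  apply: (@le_trans _ _ r); last by lra.
  by rewrite ler_pdivrMr// ler_peMr// ler1n.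
have : (u - t) ^+ 2 <= (4 * rho) ^+ 2 by rewrite ler_pXn2r ?nnegrE//; lra.
have : (4 * rho) ^+ 2 * n%:R <= (4 * rho) ^+ 2 * n%:R ^+ 2.
  by rewrite ler_wpM2l ?sqr_ge0// expr2 ler_peMl// ltW.
have -> : D ^+ 2 = (4 * rho) ^+ 2 * n%:R ^+ 2 by rewrite /D; ring.
by rewrite /n -[m.+1%:R]natr1; lra.
Qed.

(** The set contains the box [[0, u]] times [[0, q/m]^m]: there [f >= f u >= q], and the cube lies
    in the ball of radius [q]. *)
Lemma profile_volume m (f : R -> \bar R) (mu q u : R) : (0 < m)%N -> profile f ->
  0 <= u -> u <= 2^-1 -> 0 <= q ->
  lebN m.+1 (Kset m.+1 f) = mu%:E -> (q%:E <= f u)%E ->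
  (q / m%:R) ^+ m * u <= mu.
Proof.
move=> m0 pf u0 u2 q0 vol qf.
have mR : 0 < m%:R :> R by rewrite ltr0n.
have x0 (x : @pt R m.+1) : (0 <= (\1_(Kset m.+1 f) x)%:E)%E by rewrite lee_fin.
rewrite -lee_fin -vol /lebN /intN.
have -> : (q / m%:R) ^+ m * u = 1 * (q / m%:R - 0) ^+ m * (u - 0).
  by rewrite !subr0 mul1r.
apply: integral_ge_cc => [||t|t /andP[t0 tu]] //.
- by rewrite mul1r subr0 exprn_ge0// divr_ge0// ltW.
- by apply: intn_ge0 => y; exact: x0.
apply: intn_ge_box => [|||y yb] //; first by rewrite divr_ge0// ltW.
rewrite indicE mem_set//; apply/KsetP; split=> /=.
  by rewrite ger0_norm//; lra.
apply: (@le_trans _ _ q%:E).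
  by rewrite lee_fin normn_le//; apply: sqn_le_sqr_inbox yb.
by apply: (le_trans qf); apply: profile_le_norm; rewrite ?ger0_norm.
Qed.

Lemma tail_volume m (f : R -> \bar R) (r : R) : profile f ->
  0 <= r -> (f (4^-1)%R <= r%:E)%E ->
  (lebN m.+1 (Kset m.+1 f `&` [set x | (4^-1 <= `|x.1|)%R])
    <= ((2 * r) ^+ m)%:E)%E.
Proof.
move=> pf r0 fr.
set A := _ `&` _.
have x0 (x : @pt R m.+1) : (0 <= (\1_A x)%:E :> \bar R)%E by rewrite lee_fin.
rewrite /lebN /intN.
have -> : (2 * r) ^+ m = 1 * (r - - r) ^+ m * (2^-1 - - 2^-1) :> R.
  by rewrite !opprK -!mulr2n -[2^-1 *+ 2]mulr_natr mulVf// mulr1 mul1r mulr_natl.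
apply: integral_le_cc => [||t|t _|t tn].
- lra.
- by rewrite mul1r exprn_ge0//; lra.
- by apply: intn_ge0 => y; exact: x0.
- apply: intn_le_box => [|||y _|y yn] //.
  + lra.
  + by rewrite lee_fin indicE; case: (_ \in _).
  + rewrite indicE memNset// => -[/KsetP /= [t2 yf] t4].
    move/negP: yn; apply; apply: inbox_sqn_le => //; rewrite -normn_le// -lee_fin.
    apply: (le_trans yf); apply: le_trans fr.
    have -> : f t = f `|t|.
      have [?|?] := leP 0 t; first by rewrite ger0_norm.
      by rewrite ltr0_norm//; case: pf => _ [->].
    by case: pf => _ [_]; apply; rewrite ?invr_ge0.
- apply: intn_eq0 => y; rewrite indicE memNset// => -[/KsetP /= [t2 _] _].
  by move: tn; rewrite -ler_norml t2.
Qed.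

End LowerBound.

(** * The cylinder competitor *)

Section Cylinder.
Variable R : realType.
Implicit Types (m : nat) (s : R).

(** Here [d] bounds from below the distance of [y] to all integer translates of the complement.
    [Kker_le] applies, its [3/4] being [1/2 + 1/4], and the product integrates to
    [(d ^ (- s / n)) ^ n = d ^ (- s)] up to a constant. *)
Lemma inner_le m s : 0 < s ->
  exists2 M : R, 0 < M & forall (A : set (@pt R m.+1)) (y : pt m.+1) (d : R),
  0 < d -> d <= 1 -> `|y.1| <= 4^-1 ->
  (forall x : pt m.+1, `|x.1| <= 2^-1 -> ~ A x ->
    (forall k : nat,
      d ^+ 2 <= (x.1 - y.1 + k%:R) ^+ 2 + sqn m (subn_Rn m x.2 y.2)) /\
    (forall k : nat,
      d ^+ 2 <= (x.1 - y.1 - k.+1%:R) ^+ 2 + sqn m (subn_Rn m x.2 y.2))) ->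
  (intN m.+1 (fun x => (\1_(strip m.+1 `\` A) x)%:E *
     Kker m.+1 s (subpt m.+1 x y)) <= (M * d `^ (- s))%:E)%E.
Proof.
move=> s0; have n0 : 0 < m.+1%:R :> R by rewrite ltr0n.
pose e := s / m.+1%:R; have e0 : 0 < e by rewrite divr_gt0.
have ei0 : 0 < 1 + e^-1 by rewrite addr_gt0// invr_gt0.
pose M0 := 2 `^ (m.+1%:R + s) * (2 * 16 `^ (1 + e) * (1 + e^-1)).
have M00 : 0 < M0 by rewrite !mulr_gt0 ?powR_gt0.
exists (M0 * (2 * (1 + e^-1)) ^+ m.+1).
  by rewrite mulr_gt0// exprn_gt0// mulr_gt0.
move=> A y d d0 d1 y4 hA.
have -> : M0 * (2 * (1 + e^-1)) ^+ m.+1 * d `^ (- s) =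
    M0 * (2 * (1 + e^-1) * d `^ (- e)) ^+ m.+1.
  rewrite [in RHS]exprMn -mulrA; congr (_ * (_ * _)).
  rewrite -powR_mulrn ?powR_ge0// -powRrM; congr (_ `^ _).
  by rewrite /e; field; rewrite gt_eqF.
apply: (@intn_tensor_le R m.+1 e d M0 _ y) => //; first exact: ltW.
  by move=> x; apply: indic_mule_ge0; exact: Kker_ge0.
move=> x; have [[xs xA]|xn] := pselect ((strip m.+1 `\` A) x); last first.
  by rewrite indic_mule_notin// lee_fin mulr_ge0 ?(ltW M00)// tensor_ge0.
rewrite indic_mule_in//; have [h1 h2] := hA x xs xA.
apply: Kker_le => //; apply: (le_trans (ler_normB _ _)).
by move: xs; rewrite /strip /=; lra.
Qed.

(** The value 0 beyond [a] leaves the axis in [Kset]; [intn_axis] shows that it contributes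
    nothing. *)
Definition cyl (a rho t : R) : \bar R := if `|t| <= a then rho%:E else 0%E.

Lemma profile_cyl (a rho : R) : 0 <= rho -> profile (cyl a rho).
Proof.
move=> r0; rewrite /cyl; split; [|split].
- by move=> t _; case: ifP => _; rewrite lee_fin.
- by move=> t _; rewrite normrN.
- move=> t u t0 tu _; have u0 := le_trans t0 tu.
  rewrite !ger0_norm//; case: ifPn => [ua|_]; first by rewrite (le_trans tu ua).
  by case: ifP => _; rewrite lee_fin.
Qed.

(** If [|x_1| <= a], then [|x'| > rho], and [x'] is at distance at least [rho - |y'|] from [y']
    whatever the shift. Otherwise the first coordinate suffices: without shift the gap exceeds
    [a - |y_1|], and a nonzero shift leaves at least [1 - 1/2 - |y_1|]. *)
Lemma cyl_dist m (a rho d : R) (y x : @pt R m.+1) : 0 < rho -> 0 < a -> a <= 4^-1 ->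
  `|y.1| < a -> sqn m y.2 < rho ^+ 2 -> 0 <= d ->
  d <= a - `|y.1| -> d <= rho - normn m y.2 ->
  `|x.1| <= 2^-1 -> ~ Kset m.+1 (cyl a rho) x ->
  (forall k : nat,
    d ^+ 2 <= (x.1 - y.1 + k%:R) ^+ 2 + sqn m (subn_Rn m x.2 y.2)) /\
  (forall k : nat,
    d ^+ 2 <= (x.1 - y.1 - k.+1%:R) ^+ 2 + sqn m (subn_Rn m x.2 y.2)).
Proof.
move=> r0 a0 a4 ya yr d0 da dr x2 xK.
set z := sqn m _; have z0 : 0 <= z by exact: sqn_ge0.
have [xa|xa] := leP `|x.1| a.
  have xr : rho < normn m x.2.
    rewrite ltNge; apply/negP => xr; apply: xK; apply/KsetP; split=> //=.
    by rewrite /cyl xa lee_fin.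
  have dz : d ^+ 2 <= z.
    rewrite -(sqr_sqrtr z0) ler_pXn2r ?nnegrE ?sqrtr_ge0//.
    by have := normn_triangle R m x.2 y.2; rewrite {2}/normn -/z; lra.
  by split=> k; apply: (le_trans dz); rewrite lerDr sqr_ge0.
have sq (b : R) : d <= `|b| -> d ^+ 2 <= b ^+ 2 + z.
  move=> db; rewrite -[leLHS]addr0 lerD// -[leRHS]real_normK ?num_real//.
  by rewrite ler_pXn2r ?nnegrE.
have [xl xu] : - 2^-1 <= x.1 /\ x.1 <= 2^-1 by move: x2; rewrite ler_norml => /andP[].
have := ler_norm y.1; have := ler_norm (- y.1); rewrite normrN => yl yu.
split=> k; apply: sq; last first.
  have := ler_norm (- (x.1 - y.1 - k.+1%:R)); have := ler0n R k.
  by rewrite normrN -[k.+1%:R]natr1; lra.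
case: k => [|k].
  by rewrite addr0; have := lerB_dist x.1 y.1; lra.
have := ler_norm (x.1 - y.1 + k.+1%:R); have := ler0n R k.
by rewrite -[k.+1%:R]natr1; lra.
Qed.

Lemma PS_cyl_le m s (ka : R) : (0 < m)%N -> 0 < s < 1 -> 0 < ka ->
  exists2 C : R, 0 < C & forall a rho : R,
  0 < rho -> ka * rho <= a -> ka * rho <= rho -> a <= 4^-1 ->
  (PS m.+1 s (Kset m.+1 (cyl a rho)) <= (C * rho `^ (m%:R - s) * a)%:E)%E.
Proof.
move=> m0 /andP[s0 s1] ka0.
have [M M0 HM] := inner_le m s s0.
have Ns : -1 < - s by lra.
have [C1 C10 H1] := @intn_dome_le R m (- s) Ns.
have [C2 C20 H2] := @integral_dome_le R (- s) Ns.
exists (M * (ka / 2) `^ (- s) * C1 * C2); first by rewrite !mulr_gt0 ?powR_gt0 ?divr_gt0.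
move=> a rho r0 kra kr a4.
have a0 : 0 < a by apply: lt_le_trans kra; rewrite mulr_gt0.
pose P := M * (ka / 2 * rho) `^ (- s).
have P0 : 0 <= P by rewrite mulr_ge0 ?powR_ge0 ?ltW.
have a20 : 0 < a ^+ 2 by rewrite exprn_gt0.
have r20 : 0 < rho ^+ 2 by rewrite exprn_gt0.
pose G : set (@pt R m.+1) := Kset m.+1 (cyl a rho).
pose h y := ((\1_(G `&` strip m.+1) y)%:E * intN m.+1 (fun x =>
  (\1_(strip m.+1 `\` G) x)%:E * Kker m.+1 s (subpt m.+1 x y)))%E.
rewrite -[PS _ _ _]/(intN m.+1 h) /intN.
have h0 y : (0 <= h y)%E by apply: indic_mule_ge0; exact: inner_ge0.
(* The target is rewritten in the form produced by the two dome estimates; the powers with exponent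
   [s] come from normalizing [u] and [v] below. *)
have -> : M * (ka / 2) `^ (- s) * C1 * C2 * rho `^ (m%:R - s) * a =
   (P * (a ^+ 2) `^ s * (rho ^+ 2) `^ s * C1 * (rho ^+ 2) `^ (- s + m%:R / 2)) * C2 *
      (a ^+ 2) `^ (- s + 2^-1).
  have k2 : 0 <= ka / 2 by rewrite divr_ge0// ltW.
  rewrite /P (powRM _ k2 (ltW r0)) !gt0_powRD// !powRN powR12_sqrt ?(ltW a20)//.
  rewrite sqrtr_sqr (gtr0_norm a0).
  have -> : (rho ^+ 2) `^ (m%:R / 2) = rho `^ m%:R.
    rewrite -powR_mulrn ?(ltW r0)// -powRrM; congr (_ `^ _); by field.
  by field; rewrite !gt_eqF ?powR_gt0 ?divr_gt0.
apply: H2 => //.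
- rewrite !mulr_ge0 ?powR_ge0// ltW//.
- by move=> t; apply: intn_ge0 => y; exact: h0.
- move=> t ta.
  have nt : `|t| < a.
    by rewrite -(ltr_pXn2r (n := 2))// ?nnegrE ?(ltW a0)// real_normK ?num_real.
  have A0 : 0 < a ^+ 2 - t ^+ 2 by rewrite subr_gt0.
  pose u := (a ^+ 2 - t ^+ 2) / a ^+ 2; have u0 : 0 < u by rewrite divr_gt0.
  have nt2 : t ^+ 2 = `|t| ^+ 2 by rewrite real_normK ?num_real.
  have u1 : u <= 1 by rewrite ler_pdivrMr// mul1r lerBlDr lerDl sqr_ge0.
  have ua : a * u <= 2 * (a - `|t|).
    have -> : a * u = (a ^+ 2 - t ^+ 2) / a by rewrite /u; field; rewrite gt_eqF.
    by rewrite ler_pdivrMr// nt2; have := sqr_ge0 (a - `|t|); rewrite !expr2; lra.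
  rewrite [X in X%:E](_ : _ = P * u `^ (- s) * (rho ^+ 2) `^ s * C1 *
     (rho ^+ 2) `^ (- s + m%:R / 2)); last first.
    have ai0 : 0 <= (a ^+ 2)^-1 by rewrite invr_ge0 ltW.
    rewrite /u (powRM _ (ltW A0) ai0).
    have -> : (a ^+ 2)^-1 `^ (- s) = (a ^+ 2) `^ s.
      by rewrite -[_^-1]powR_inv1 ?(ltW a20)// -powRrM mulN1r opprK.
    by ring.
  apply: H1 => //.
  + by apply: mulr_ge0; [apply: mulr_ge0|]; rewrite ?powR_ge0.
  + move=> y yr.
    have B0 : 0 < rho ^+ 2 - sqn m y by rewrite subr_gt0.
    pose v := (rho ^+ 2 - sqn m y) / rho ^+ 2; have v0 : 0 < v by rewrite divr_gt0.
    have v1 : v <= 1 by rewrite ler_pdivrMr// mul1r lerBlDr lerDl sqn_ge0.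
    have nr : normn m y < rho.
      by rewrite ltNge -{1}(gtr0_norm r0) -sqrtr_sqr ler_sqrt ?sqn_ge0// -ltNge.
    have n2 : sqn m y = normn m y ^+ 2 by rewrite sqr_sqrtr ?sqn_ge0.
    have vr : rho * v <= 2 * (rho - normn m y).
      have -> : rho * v = (rho ^+ 2 - sqn m y) / rho.
        by rewrite /v; field; rewrite gt_eqF.
      by rewrite ler_pdivrMr// n2; have := sqr_ge0 (rho - normn m y);
         rewrite !expr2; lra.
    (* [d] is below both distances, because [ka * rho] is at most [a] and [rho], [u] and [v] are at
       most 1, and [a * u] and [rho * v] are at most twice the distances to the end and to the
       side. *)
    pose d := ka / 2 * rho * u * v.
    have d0 : 0 < d by rewrite !mulr_gt0 ?invr_gt0.
    have uv1 : u * v <= u by rewrite ler_piMr// ltW.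
    have uv2 : u * v <= v by rewrite ler_piMl// ltW.
    have kr0 : 0 < ka * rho by rewrite mulr_gt0.
    have da : d <= a - `|t|.
      have : ka * rho * (u * v) <= a * u 
        by apply: ler_pM => //; [exact: ltW|apply: mulr_ge0; exact: ltW].
      by rewrite /d; lra.
    have dr : d <= rho - normn m y.
      have : ka * rho * (u * v) <= rho * v 
        by apply: ler_pM => //; [exact: ltW|apply: mulr_ge0; exact: ltW].
      by rewrite /d; lra.
    have -> : P * u `^ (- s) * (rho ^+ 2) `^ s * (rho ^+ 2 - sqn m y) `^ (- s)
        = M * d `^ (- s).
      have w0 : 0 <= ka / 2 * rho by rewrite mulr_ge0 ?divr_ge0 ?ltW.
      rewrite /d (powRM _ (mulr_ge0 w0 (ltW u0)) (ltW v0)) (powRM _ w0 (ltW u0)).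
      have ri0 : 0 <= (rho ^+ 2)^-1 by rewrite invr_ge0 ltW.
      rewrite /v (powRM _ (ltW B0) ri0).
      have -> : (rho ^+ 2)^-1 `^ (- s) = (rho ^+ 2) `^ s.
        by rewrite -[_^-1]powR_inv1 ?(ltW r20)// -powRrM mulN1r opprK.
      by rewrite /P; ring.
    rewrite /h; have [yK|yK] := pselect ((G `&` strip m.+1) (t, y)).
      rewrite indic_mule_in//; apply: HM => //=.
      - by have := normr_ge0 t; lra.
      - by lra.
      - move=> x x2 xA; apply: (@cyl_dist m a rho d (t, y) x) => //.
        exact: ltW.
    by rewrite indic_mule_notin// lee_fin mulr_ge0 ?powR_ge0 ?ltW.
  + move=> y yr; rewrite /h indic_mule_notin// => -[/KsetP /= [_]].
    by rewrite /cyl (ltW nt) lee_fin normn_le ?(ltW r0)// leNgt yr.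
- move=> t ta; have nt : a < `|t|.
    by rewrite -(ltr_pXn2r (n := 2))// ?nnegrE ?(ltW a0)// real_normK ?num_real.
  apply: intn_axis => // y y0; rewrite /h indic_mule_notin// => -[/KsetP /= [_]].
  have /negbTE na : ~~ (`|t| <= a) by rewrite -ltNge.
  by rewrite /cyl na lee_fin normn_le// expr0n/= leNgt y0.
Qed.

Lemma cyl_volume m (a rho V : R) : (0 < m)%N -> 0 <= rho -> 0 <= a -> a <= 2^-1 ->
  intn m (fun y => (if sqn m y <= rho ^+ 2 then 1 else 0)%:E) = V%:E ->
  lebN m.+1 (Kset m.+1 (cyl a rho)) = (V * (2 * a))%:E.
Proof.
move=> m0 r0 a0 a2 hV.
have -> : 2 * a = a - - a by ring.
rewrite -integral_cc_cst; last by rewrite ge0_cp.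
apply: eq_integral => t _; rewrite -ler_norml; case: ifPn => ta.
  rewrite -hV; congr intn; apply/funext => y; rewrite indicE -normn_le//.
  case: ifPn => yr.
    rewrite mem_set//; apply/KsetP; split=> /=; first exact: le_trans a2.
    by rewrite /cyl ta lee_fin.
  rewrite memNset// => /KsetP /= [_].
  by rewrite /cyl ta lee_fin (negbTE yr).
apply: intn_axis => // y y0.
rewrite indicE memNset// => /KsetP /= [_].
by rewrite /cyl (negbTE ta) lee_fin normn_le// expr0n/= leNgt y0.
Qed.

(** The ball lies between the cubes [[0, rho/m]^m] and [[-rho, rho]^m]. In particular its volume is
    a finite positive number when [rho > 0], by which the height of the competitor can be
    defined. *)
Lemma ball_volume m (rho : R) : (0 < m)%N -> 0 <= rho ->
  exists2 V : R, (rho / m%:R) ^+ m <= V <= (2 * rho) ^+ m &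
  intn m (fun y => (if sqn m y <= rho ^+ 2 then 1 else 0)%:E) = V%:E.
Proof.
move=> m0 r0; set I := intn m _.
have f0 (y : Rn R m) : (0 <= (if sqn m y <= rho ^+ 2 then 1 else 0)%:E :> \bar R)%E.
  by case: ifP.
have lo : (((rho / m%:R) ^+ m)%:E <= I)%E.
  rewrite -[X in X%:E]mul1r -{1}[rho / _]subr0.
  apply: intn_ge_box => // [|y yb]; first by rewrite divr_ge0.
  by rewrite sqn_le_sqr_inbox.
have hi : (I <= ((2 * rho) ^+ m)%:E)%E.
  have -> : (2 * rho) ^+ m = 1 * (rho - - rho) ^+ m.
    by rewrite mul1r opprK; congr (_ ^+ _); ring.
  apply: intn_le_box => // [|y _|y yb].
  - by rewrite ge0_cp.
  - by case: ifP.
  - by case: ifPn => // /(inbox_sqn_le _ _ _ _ r0); rewrite (negbTE yb).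
have fI : I \is a fin_num.
  by rewrite ge0_fin_numE ?(le_lt_trans hi) ?ltry//; exact: intn_ge0.
by exists (fine I); rewrite ?fineK// -!lee_fin fineK// lo hi.
Qed.

Lemma competitor m s : (0 < m)%N -> 0 < s < 1 ->
  exists C mu0 : R, [/\ 0 < C, 0 < mu0 & forall mu : R, 0 < mu -> mu <= mu0 ->
  exists2 F : set (@pt R m.+1), inK m.+1 F /\ lebN m.+1 F = mu%:E &
  (PS m.+1 s F <= (C * mu `^ (1 - s / m.+1%:R))%:E)%E].
Proof.
move=> m0 s01.
have mR : 0 < m%:R :> R by rewrite ltr0n.
(* With [rho = mu ^ (1/n)] and half-height [a = mu / (2 V)] the volume is exactly [mu]. The bound
   [V <= (2 rho)^m] gives [a >= ka * rho], the bound [V >= (rho/m)^m] gives [a <= L * rho], and the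
   threshold on [mu] makes [L * rho <= 1/4]. *)
have n0 : 0 < m.+1%:R :> R by rewrite ltr0n.
pose ka : R := 2^-1 ^+ m.+1; have ka0 : 0 < ka by rewrite exprn_gt0.
have ka1 : ka <= 1 by apply: exprn_ile1; lra.
have [C C0 HC] := PS_cyl_le m s ka m0 s01 ka0.
pose L : R := m%:R ^+ m / 2; have L0 : 0 < L by rewrite divr_gt0 ?exprn_gt0.
exists (C * L), ((4 * L)^-1 `^ m.+1%:R); split.
- exact: mulr_gt0.
- by rewrite powR_gt0// invr_gt0; exact: mulr_gt0.
move=> mu mu_gt0 mule; pose rho := mu `^ m.+1%:R^-1.
have r0 : 0 < rho by exact: powR_gt0.
have rn : rho ^+ m.+1 = mu.
  by rewrite -powR_mulrn ?(ltW r0)// -powRrM mulVf ?gt_eqF// powRr1 ?ltW.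
have rL : rho <= (4 * L)^-1.
  have : rho <= ((4 * L)^-1 `^ m.+1%:R) `^ m.+1%:R^-1.
    by apply: ge0_ler_powR; rewrite ?nnegrE ?invr_ge0 ?powR_ge0 ?(ltW mu_gt0) ?ler0n.
  by rewrite -powRrM mulfV ?gt_eqF// powRr1// invr_ge0 ltW// mulr_gt0.
have [V /andP[Vl Vu] hV] := ball_volume m rho m0 (ltW r0).
have rm0 : 0 < rho ^+ m by rewrite exprn_gt0.
have V0 : 0 < V by apply: lt_le_trans Vl; rewrite exprn_gt0// divr_gt0.
pose a := mu / (2 * V); have a0 : 0 < a by rewrite divr_gt0// mulr_gt0.
have aL : a <= rho * L.
  rewrite ler_pdivrMr ?mulr_gt0// -rn exprS -mulrA ler_pM2l//.
  move: Vl; rewrite expr_div_n ler_pdivrMr ?exprn_gt0// => /le_trans; apply.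
  by rewrite le_eqVlt; apply/orP; left; apply/eqP; rewrite /L; field.
have ak : ka * rho <= a.
  rewrite ler_pdivlMr ?mulr_gt0// -rn exprS mulrAC [_ * rho]mulrC ler_pM2l//.
  have k2 : ka * 2 * 2 ^+ m = 1.
    by rewrite /ka -mulrA -exprS -exprMn mulVf ?expr1n.
  have k20 : 0 <= ka * 2 by rewrite mulr_ge0// ltW.
  rewrite mulrA; apply: (le_trans (ler_wpM2l k20 Vu)).
  by rewrite exprMn mulrA k2 mul1r.
have a4 : a <= 4^-1.
  apply: (le_trans aL); apply: (le_trans (ler_wpM2r (ltW L0) rL)).
  by rewrite invfM mulrVK ?unitfE ?gt_eqF.
exists (Kset m.+1 (cyl a rho)).
  split; first by exists (cyl a rho); split=> //; apply: profile_cyl; exact: ltW.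
  rewrite (cyl_volume _ _ _ V)//; [|exact: ltW|exact: ltW|lra].
  by congr EFin; rewrite /a; field; rewrite gt_eqF.
apply: (le_trans (HC a rho r0 ak _ a4)); first by rewrite ler_piMl// ltW.
rewrite lee_fin -2!(mulrA C) ler_pM2l//.
apply: (@le_trans _ _ (rho `^ (m%:R - s) * (rho * L))).
  by rewrite ler_wpM2l ?powR_ge0.
rewrite mulrA [L * _]mulrC ler_pM2r//.
have -> : rho `^ (m%:R - s) * rho = rho `^ (m.+1%:R - s).
  by rewrite -{2}[rho]powRr1 ?(ltW r0)// -gt0_powRD// -natr1; congr (_ `^ _); ring.
rewrite /rho -powRrM le_eqVlt; apply/orP; left; apply/eqP; congr (_ `^ _).
by field; rewrite gt_eqF.
Qed.

End Cylinder.

(** * The estimate for minimizers *)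

Section MainEstimate.
Variable R : realType.

Lemma profile_ub (m : nat) (f : R -> \bar R) (mu : R) : (0 < m)%N -> profile f ->
  0 < mu -> lebN m.+1 (Kset m.+1 f) = mu%:E ->
  (f (8^-1)%R <= (m%:R * 8 `^ m%:R^-1 * mu `^ m%:R^-1)%:E)%E.
Proof.
move=> m0 pf mu0 vol; have mR : 0 < m%:R :> R by rewrite ltr0n.
(* Arguing with every finite [q] below [f(1/8)] also excludes the value [+oo], by taking [q] one
   above the bound. *)
have key (q : R) : 0 <= q -> (q%:E <= f (8^-1)%R)%E ->
    q <= m%:R * 8 `^ m%:R^-1 * mu `^ m%:R^-1.
  move=> q0 qf.
  have q1 : (q / m%:R) ^+ m <= 8 * mu.
    have e0 : 0 <= 8^-1 :> R by [].
    have e2 : 8^-1 <= 2^-1 :> R by lra.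
    by have := profile_volume R _ _ _ _ _ m0 pf e0 e2 q0 vol qf; lra.
  have qm : 0 <= q / m%:R by rewrite divr_ge0// ltW.
  have : ((q / m%:R) ^+ m) `^ m%:R^-1 <= (8 * mu) `^ m%:R^-1.
    by apply: ge0_ler_powR;
       rewrite ?nnegrE ?invr_ge0 ?exprn_ge0 ?mulr_ge0 ?(ltW mu0) ?(ltW mR).
  rewrite -powR_mulrn// -powRrM mulfV ?gt_eqF// powRr1// ler_pdivrMr//.
  move=> /le_trans; apply.
  by rewrite powRM ?(ltW mu0)// mulrC mulrA.
have f0 : (0 <= f (8^-1)%R)%E by case: pf => h _; apply: h; rewrite ger0_norm; lra.
move: f0 key; case: (f _) => [q| |] // q0 key.
  by rewrite lee_fin; apply: key => //; rewrite -lee_fin.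
set B := m%:R * _ * _ in key *.
have B0 : 0 <= B by rewrite !mulr_ge0 ?powR_ge0// ltW.
by exfalso; have := key (B + 1) (addr_ge0 B0 ler01) (leey _); lra.
Qed.

Lemma minimizer_bound (m : nat) (s : R) : (0 < m)%N -> 0 < s < 1 ->
  exists2 C : R, 0 < C & forall (mu : R) (f : R -> \bar R),
    0 < mu -> profile f -> lebN m.+1 (Kset m.+1 f) = mu%:E ->
    (forall F : set (@pt R m.+1), inK m.+1 F -> lebN m.+1 F = mu%:E ->
       (PS m.+1 s (Kset m.+1 f) <= PS m.+1 s F)%E) ->
  (f (4^-1)%R <= (C * mu `^ (m%:R^-1 + s / (m.+1%:R ^+ 2 * m%:R)))%:E)%E.
Proof.
move=> m0 s01; have /andP[s0 s1] := s01.
have mR : 0 < m%:R :> R by rewrite ltr0n.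
have nR : 0 < m.+1%:R :> R by rewrite ltr0n.
have [CU [muU [CU0 muU0 HU]]] := competitor R m s m0 s01.
have [c c0 HL] := PS_ge R m s m0 s0.
pose C1 : R := m%:R * 8 `^ m%:R^-1.
have C10 : 0 < C1 by rewrite mulr_gt0 ?powR_gt0.
pose e := s / (m.+1%:R ^+ 2 * m%:R).
have e0 : 0 < e by rewrite divr_gt0// mulr_gt0 ?exprn_gt0.
pose muL := (4 * C1)^-1 ^+ m.
have muL0 : 0 < muL by rewrite exprn_gt0// invr_gt0 mulr_gt0.
pose mu0 := Num.min 1 (Num.min muU muL).
have mu00 : 0 < mu0 by rewrite !lt_min ltr01 muU0 muL0.
pose B := CU * C1 `^ s / c.
have B0 : 0 < B by rewrite divr_gt0 ?mulr_gt0 ?powR_gt0.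
(* The first summand serves [mu <= mu0], where minimality is used; the second serves [mu > mu0],
   where [mu ^ e] is bounded below. *)
exists (B `^ m%:R^-1 + C1 * mu0 `^ (- e)).
  by rewrite addr_gt0 ?mulr_gt0 ?powR_gt0.
move=> mu f mu_gt0 pf vol fmin.
have f8 := profile_ub m f mu m0 pf mu_gt0 vol; rewrite -/C1 in f8.
have f48 : (f (4^-1)%R <= f (8^-1)%R)%E.
  by apply: profile_le_norm => //; rewrite ?ger0_norm; lra.
have f40 : (0 <= f (4^-1)%R)%E by case: pf => h _; apply: h; rewrite ger0_norm; lra.
have : f (4^-1)%R \is a fin_num.
  by rewrite ge0_fin_numE// (le_lt_trans f48)// (le_lt_trans f8)// ltry.
move=> /fineK; set r := fine _ => rE; rewrite -rE lee_fin.
have r0 : 0 <= r by rewrite -lee_fin rE.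
have r8 : r <= C1 * mu `^ m%:R^-1 by rewrite -lee_fin rE (le_trans f48).
rewrite gt0_powRD//; have [mule|mugt] := leP mu mu0; last first.
  rewrite mulrDl -[leLHS]add0r lerD//; first by rewrite !mulr_ge0 ?powR_ge0.
  apply: (le_trans r8); rewrite -mulrA ler_pM2l// mulrCA ler_peMr ?powR_ge0//.
  rewrite powRN -/e ler_pdivlMl ?powR_gt0// mulr1.
  by apply: ge0_ler_powR; rewrite ?nnegrE ltW.
have [mu1 muU' muL'] : [/\ mu <= 1, mu <= muU & mu <= muL].
  by move: mule; rewrite /mu0 !le_min => /and3P[].
rewrite mulrDl -[leLHS]addr0 lerD//; last by rewrite !mulr_ge0 ?powR_ge0// ltW.
have [F [FK Fvol] FP] := HU mu mu_gt0 muU'.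
pose rho := C1 * mu `^ m%:R^-1.
have rho0 : 0 < rho by rewrite mulr_gt0 ?powR_gt0.
have rho4 : rho <= 4^-1.
  have : mu `^ m%:R^-1 <= muL `^ m%:R^-1.
    by apply: ge0_ler_powR => //; rewrite ?nnegrE ?invr_ge0; exact: ltW.
  have C4 : 0 <= (4 * C1)^-1 by rewrite invr_ge0 ltW// mulr_gt0.
  rewrite /muL -powR_mulrn// -powRrM mulfV ?gt_eqF// powRr1//.
  rewrite -(ler_pM2l C10) => /le_trans; apply.
  by rewrite le_eqVlt; apply/orP; left; apply/eqP; field; rewrite gt_eqF.
have : ((c * r ^+ m * rho `^ (- s))%:E <= (CU * mu `^ (1 - s / m.+1%:R))%:E)%E.
  apply: le_trans FP; apply: le_trans (fmin _ FK Fvol).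
  by apply: HL => //; rewrite rE.
rewrite lee_fin powRN ler_pdivrMr ?powR_gt0// => H.
(* Moving [rho ^ (- s)] across adds [s / m] to the exponent, and [1 - s / n + s / m = 1 + s / (n m)]
   because [n = m + 1]. *)
have {}H : r ^+ m <= B * mu `^ (1 + s / (m.+1%:R * m%:R)).
  have := H; rewrite -ler_pdivlMl// => /le_trans; apply.
  rewrite /rho powRM ?powR_ge0 ?(ltW C10)// -powRrM.
  rewrite le_eqVlt; apply/orP; left; apply/eqP.
  have -> : 1 + s / (m.+1%:R * m%:R) = (1 - s / m.+1%:R) + m%:R^-1 * s.
    by rewrite -[m.+1%:R]natr1; field; rewrite !gt_eqF// natr1.
  by rewrite (gt0_powRD _ mu (1 - s / m.+1%:R))// /B; ring.
have : (r ^+ m) `^ m%:R^-1 <= (B * mu `^ (1 + s / (m.+1%:R * m%:R))) `^ m%:R^-1.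
  apply: ge0_ler_powR => //; rewrite ?nnegrE ?invr_ge0 ?exprn_ge0//.
  by apply: mulr_ge0; [exact: ltW|exact: powR_ge0].
rewrite -powR_mulrn// -powRrM mulfV ?gt_eqF// powRr1// => /le_trans; apply.
rewrite powRM ?powR_ge0 ?(ltW B0)// -powRrM ler_pM2l ?powR_gt0// -gt0_powRD//.
(* Since [mu <= 1], the exponent [1/m + s / (n m^2)] may be lowered to [1/m + s / (n^2 m)]. *)
apply: ger_powR; first by rewrite mu_gt0.
rewrite mulrDl mul1r lerD2l -mulrA ler_pM2l// -invfM.
rewrite lef_pV2 ?posrE ?mulr_gt0 ?exprn_gt0//.
by rewrite expr2 ler_pM2r// ler_pM2l// ler_nat.
Qed.

End MainEstimate.

(** * Both assertions, from the bound on the radius at [1/4] *)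

Theorem theorem1p2 (R : realType) (n : nat) (s : R) :
  (2 <= n)%N -> 0 < s < 1 ->
  exists C : R, 1 < C /\
  forall (mu : R) (f : R -> \bar R),
    0 < mu ->
    profile f ->
    lebN n (Kset n f) = mu%:E ->
    (forall F : set (@pt R n), inK n F -> lebN n F = mu%:E ->
       (PS n s (Kset n f) <= PS n s F)%E) ->
    (f (4^-1)%R * ((mu `^ (n.-1%:R)^-1)^-1)%:E
       <= (C * mu `^ (s / (n%:R ^+ 2 * n.-1%:R)))%:E)%E /\
    (forall delta : R, 0 < delta < 1 ->
       mu < C^-1 * delta `^ (n%:R ^+ 2 / s) ->
       (lebN n (Kset n f `&` [set x | (4^-1 <= `|x.1|)%R]) * (mu^-1)%:E
          <= delta%:E)%E).
Proof.
case: n => // m; rewrite ltnS => m0 s01; rewrite [m.+1.-1]/=.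
have mR : 0 < m%:R :> R by rewrite ltr0n.
have nR : 0 < m.+1%:R :> R by rewrite ltr0n.
have /andP[s0 s1] := s01.
have [C C0 HC] := minimizer_bound R m s m0 s01.
pose D := (2 * C) ^+ m; have D0 : 0 < D by rewrite exprn_gt0// mulr_gt0.
pose p := m.+1%:R ^+ 2 / s; have p0 : 0 < p by rewrite divr_gt0// exprn_gt0.
pose e := s / (m.+1%:R ^+ 2 * m%:R).
have Dp0 : 0 < D `^ p by exact: powR_gt0.
(* The summand 2 makes the constant exceed 1, [C] serves the first assertion and [D ^ p] the
   second. *)
exists (2 + C + D `^ p); split; first by lra.
move=> mu f mu0 pf vol fmin; have {HC} := HC mu f mu0 pf vol fmin; rewrite -/e => f4.
have pm0 : 0 < mu `^ m%:R^-1 by exact: powR_gt0.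
split.
  have pmi0 : (0 <= ((mu `^ m%:R^-1)^-1)%:E)%E by rewrite lee_fin invr_ge0 ltW.
  apply: (le_trans (lee_wpmul2r pmi0 f4)); rewrite -EFinM lee_fin gt0_powRD//.
  have -> : C * (mu `^ m%:R^-1 * mu `^ e) / mu `^ m%:R^-1 = C * mu `^ e.
    by field; rewrite gt_eqF.
  by rewrite ler_wpM2r ?powR_ge0//; lra.
move=> delta /andP[d0 d1]; rewrite -/p => hmu.
have r0 : 0 <= C * mu `^ (m%:R^-1 + e) by rewrite mulr_ge0 ?powR_ge0 ?ltW.
have mi0 : (0 <= (mu^-1)%:E)%E by rewrite lee_fin invr_ge0 ltW.
apply: (le_trans (lee_wpmul2r mi0 (tail_volume R m f _ pf r0 f4))).
rewrite -EFinM lee_fin mulrA exprMn -/D -powR_mulrn ?powR_ge0// -powRrM.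
have -> : (m%:R^-1 + e) * m%:R = 1 + p^-1.
  by rewrite /e /p; field; rewrite !gt_eqF.
rewrite gt0_powRD// powRr1 ?(ltW mu0)//.
have -> : D * (mu * mu `^ p^-1) / mu = D * mu `^ p^-1 by field; rewrite gt_eqF.
(* The claim [D * mu ^ (1/p) <= delta] is the [p]-th root of [D ^ p * mu <= delta ^ p], which the
   smallness of [mu] provides. *)
have -> : delta = (delta `^ p) `^ p^-1.
  by rewrite -powRrM mulfV ?gt_eqF// powRr1// ltW.
have {1}-> : D = (D `^ p) `^ p^-1.
  by rewrite -powRrM mulfV ?gt_eqF// powRr1// ltW.
rewrite -powRM ?powR_ge0 ?(ltW mu0)//.
apply: ge0_ler_powR.
- by rewrite invr_ge0 ltW.
- by rewrite nnegrE mulr_ge0 ?powR_ge0 ?ltW.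
- by rewrite nnegrE powR_ge0.
move: hmu; rewrite ltr_pdivlMl; last by lra.
by have := mulr_gt0 C0 mu0; lra.
Qed.
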